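(* Let $\Lambda$ be a self-injective artin algebra, let $n>1$ be an integer and let $\mathcal{M}$ be an $n$-cluster tilting subcategory of $\mathrm{mod}\text{-}\Lambda$. There exists an equivalence of abelian categories $$\mathcal{S}(\mathcal{M})/\mathcal{U}\simeq\mathrm{mod}\text{-}\underline{\mathcal{M}},$$ where $\mathcal{U}$ is the subcategory of $\mathcal{S}(\mathcal{M})$ generated by the objects of the form $(M\xrightarrow{1}M)$ and $(M\xrightarrow{f}P)$, where $M\in\mathcal{M}$ and $P$ is a projective $\Lambda$-module.
   Context: $\mathrm{mod}\text{-}\Lambda$ is the category of finitely generated $\Lambda$-modules; all subcategories are full. A full additive subcategory $\mathcal{M}$ of $\mathrm{mod}\text{-}\Lambda$ is $n$-cluster tilting if it is functorially finite (every module has a right and a left $\mathcal{M}$-approximation), generating-cogenerating (every module is a quotient of an object of $\mathcal{M}$ and embeds in an object of $\mathcal{M}$), and $$\mathcal{M}=\{A: \mathrm{Ext}^i_\Lambda(\mathcal{M},A)=0,\ 0<i<n\}=\{A: \mathrm{Ext}^i_\Lambda(A,\mathcal{M})=0,\ 0<i<n\}.$$ $\mathcal{S}(\mathcal{M})$ is the category whose objects are monomorphisms $f:M_1\to M_2$ of $\Lambda$-modules with $M_1,M_2\in\mathcal{M}$, and whose morphisms are commutative squares. $\mathrm{mod}\text{-}\underline{\mathcal{M}}$ is the (abelian) category of finitely presented additive contravariant functors $\mathcal{M}\to\mathrm{Ab}$ that vanish on projective $\Lambda$-modules; equivalently, the finitely presented additive contravariant functors on $\underline{\mathcal{M}}$,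 the quotient of $\mathcal{M}$ by morphisms factoring through projective $\Lambda$-modules. For a class $\mathcal{K}$ of objects of an additive category $\mathcal{X}$, $\mathcal{X}/\mathcal{K}$ is the quotient of $\mathcal{X}$ by the ideal of morphisms factoring through a finite direct sum of objects of $\mathcal{K}$. *)

(* Defs.v *)
From HB Require Import structures.
From mathcomp Require Import all_boot all_algebra.
From mathcomp Require Import boolp.
From Stdlib Require Import Setoid Morphisms.

Set Implicit Arguments.
Unset Strict Implicit.
Unset Printing Implicit Defensive.

Import GRing.Theory.
Local Open Scope ring_scope.

Declare Scope cat_scope.
Delimit Scope cat_scope with cat.
Local Open Scope cat_scope.

Reserved Notation "f =~ g" (at level 70, no associativity).
Reserved Notation "g @o f" (at level 40, left associativity).
Reserved Notation "f +~ g" (at level 50, left associativity).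

(* A preadditive category.  Every hom-set carries its own equality [heq], so   *)
(* that a quotient category keeps the objects and the morphisms and only       *)
(* coarsens the equality of morphisms.                                         *)
Record preadd := Preadd {
  obj :> Type;
  hom : obj -> obj -> Type;
  heq : forall X Y, hom X Y -> hom X Y -> Prop;
  idm : forall X, hom X X;
  comp : forall X Y Z, hom Y Z -> hom X Y -> hom X Z;
  zerom : forall X Y, hom X Y;
  addm : forall X Y, hom X Y -> hom X Y -> hom X Y;
  oppm : forall X Y, hom X Y -> hom X Y;
  heq_equiv : forall X Y, Equivalence (@heq X Y);
  comp_ext : forall X Y Z (g g' : hom Y Z) (f f' : hom X Y),
    heq g g' -> heq f f' -> heq (comp g f) (comp g' f');
  addm_ext : forall X Y (f f' g g' : hom X Y),
    heq f f' -> heq g g' -> heq (addm f g) (addm f' g');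
  oppm_ext : forall X Y (f f' : hom X Y), heq f f' -> heq (oppm f) (oppm f');
  comp_assoc : forall X Y Z W (h : hom Z W) (g : hom Y Z) (f : hom X Y),
    heq (comp h (comp g f)) (comp (comp h g) f);
  comp_idl : forall X Y (f : hom X Y), heq (comp (idm Y) f) f;
  comp_idr : forall X Y (f : hom X Y), heq (comp f (idm X)) f;
  addm_assoc : forall X Y (f g h : hom X Y),
    heq (addm f (addm g h)) (addm (addm f g) h);
  addm_comm : forall X Y (f g : hom X Y), heq (addm f g) (addm g f);
  addm_zero : forall X Y (f : hom X Y), heq (addm (zerom X Y) f) f;
  addm_opp : forall X Y (f : hom X Y), heq (addm (oppm f) f) (zerom X Y);
  comp_addl : forall X Y Z (g g' : hom Y Z) (f : hom X Y),
    heq (comp (addm g g') f) (addm (comp g f) (comp g' f));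
  comp_addr : forall X Y Z (g : hom Y Z) (f f' : hom X Y),
    heq (comp g (addm f f')) (addm (comp g f) (comp g f'))
}.

Arguments hom {p} X Y.
Arguments heq {p X Y} f g.
Arguments idm {p} X.
Arguments comp {p X Y Z} g f.
Arguments zerom {p} X Y.
Arguments addm {p X Y} f g.
Arguments oppm {p X Y} f.

Notation "f =~ g" := (heq f g) : cat_scope.
Notation "g @o f" := (comp g f) : cat_scope.
Notation "f +~ g" := (addm f g) : cat_scope.

#[export] Existing Instance heq_equiv.

#[export] Instance comp_proper (C : preadd) (X Y Z : C) :
  Proper (heq ==> heq ==> heq) (@comp C X Y Z).
Proof. by move=> g g' eg f f' ef; apply: comp_ext. Qed.

#[export] Instance addm_proper (C : preadd) (X Y : C) :
  Proper (heq ==> heq ==> heq) (@addm C X Y).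
Proof. by move=> g g' eg f f' ef; apply: addm_ext. Qed.

#[export] Instance oppm_proper (C : preadd) (X Y : C) :
  Proper (heq ==> heq) (@oppm C X Y).
Proof. by move=> f f' ef; apply: oppm_ext. Qed.

Lemma heq_refl (C : preadd) (X Y : C) (f : hom X Y) : f =~ f.
Proof. reflexivity. Qed.
#[export] Hint Resolve heq_refl : core.

Section PreaddTheory.
Variable C : preadd.

Lemma addm_zeror (X Y : C) (f : hom X Y) : f +~ zerom X Y =~ f.
Proof. by rewrite addm_comm addm_zero. Qed.

Lemma addm_oppr (X Y : C) (f : hom X Y) : f +~ oppm f =~ zerom X Y.
Proof. by rewrite addm_comm addm_opp. Qed.

Lemma addm_cancel (X Y : C) (f g : hom X Y) : f +~ g =~ g -> f =~ zerom X Y.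
Proof.
by move=> e; rewrite -(addm_zeror f) -(addm_oppr g) addm_assoc e.
Qed.

Lemma addm_uniq (X Y : C) (f g : hom X Y) : f +~ g =~ zerom X Y -> f =~ oppm g.
Proof.
by move=> e; rewrite -(addm_zeror f) -(addm_oppr g) addm_assoc e addm_zero.
Qed.

Lemma comp_zerol (X Y Z : C) (f : hom X Y) : zerom Y Z @o f =~ zerom X Z.
Proof. by apply: (@addm_cancel _ _ _ (zerom Y Z @o f)); rewrite -comp_addl addm_zero. Qed.

Lemma comp_zeror (X Y Z : C) (g : hom Y Z) : g @o zerom X Y =~ zerom X Z.
Proof. by apply: (@addm_cancel _ _ _ (g @o zerom X Y)); rewrite -comp_addr addm_zero. Qed.

Lemma comp_oppl (X Y Z : C) (g : hom Y Z) (f : hom X Y) :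
  oppm g @o f =~ oppm (g @o f).
Proof. by apply: addm_uniq; rewrite -comp_addl addm_opp comp_zerol. Qed.

Lemma comp_oppr (X Y Z : C) (g : hom Y Z) (f : hom X Y) :
  g @o oppm f =~ oppm (g @o f).
Proof. by apply: addm_uniq; rewrite -comp_addr addm_opp comp_zeror. Qed.

Lemma oppm_opp (X Y : C) (f : hom X Y) : oppm (oppm f) =~ f.
Proof. by symmetry; apply: addm_uniq; rewrite addm_oppr. Qed.

Lemma addmACA (X Y : C) (a b c d : hom X Y) :
  (a +~ b) +~ (c +~ d) =~ (a +~ c) +~ (b +~ d).
Proof.
by rewrite -!addm_assoc (addm_assoc b) (addm_comm b c) -(addm_assoc c).
Qed.

Lemma oppm_add (X Y : C) (f g : hom X Y) :
  oppm (f +~ g) =~ oppm f +~ oppm g.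
Proof. by symmetry; apply: addm_uniq; rewrite addmACA !addm_opp addm_zero. Qed.

End PreaddTheory.

#[local] Obligation Tactic := idtac.

Program Definition opcat (C : preadd) : preadd :=
  @Preadd C (fun X Y => @hom C Y X) (fun X Y => @heq C Y X) (@idm C)
    (fun X Y Z g f => comp f g) (fun X Y => zerom Y X)
    (fun X Y => @addm C Y X) (fun X Y => @oppm C Y X)
    _ _ _ _ _ _ _ _ _ _ _ _ _.
Next Obligation. by move=> *; apply: comp_ext. Qed.
Next Obligation. by move=> *; apply: addm_ext. Qed.
Next Obligation. by move=> *; apply: oppm_ext. Qed.
Next Obligation. by move=> * /=; symmetry; apply: comp_assoc. Qed.
Next Obligation. by move=> *; apply: comp_idr. Qed.
Next Obligation. by move=> *; apply: comp_idl. Qed.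
Next Obligation. by move=> *; apply: addm_assoc. Qed.
Next Obligation. by move=> *; apply: addm_comm. Qed.
Next Obligation. by move=> *; apply: addm_zero. Qed.
Next Obligation. by move=> *; apply: addm_opp. Qed.
Next Obligation. by move=> *; apply: comp_addr. Qed.
Next Obligation. by move=> *; apply: comp_addl. Qed.

Program Definition fullsub (C : preadd) (P : C -> Prop) : preadd :=
  @Preadd {X : C | P X} (fun X Y => hom (sval X) (sval Y)) (fun X Y => heq)
    (fun X => idm (sval X)) (fun X Y Z => comp)
    (fun X Y => zerom (sval X) (sval Y)) (fun X Y => addm) (fun X Y => oppm)
    _ _ _ _ _ _ _ _ _ _ _ _ _.
Next Obligation. by move=> *; apply: comp_ext. Qed.
Next Obligation. by move=> *; apply: addm_ext. Qed.
Next Obligation. by move=> *; apply: oppm_ext. Qed.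
Next Obligation. by move=> *; apply: comp_assoc. Qed.
Next Obligation. by move=> *; apply: comp_idl. Qed.
Next Obligation. by move=> *; apply: comp_idr. Qed.
Next Obligation. by move=> *; apply: addm_assoc. Qed.
Next Obligation. by move=> *; apply: addm_comm. Qed.
Next Obligation. by move=> *; apply: addm_zero. Qed.
Next Obligation. by move=> *; apply: addm_opp. Qed.
Next Obligation. by move=> *; apply: comp_addl. Qed.
Next Obligation. by move=> *; apply: comp_addr. Qed.

Record arrow (C : preadd) := Arrow { src : C; tgt : C; arr : hom src tgt }.
Arguments Arrow {C src tgt} arr.

Record square (C : preadd) (a b : arrow C) := Square {
  sq_src : hom (src a) (src b);
  sq_tgt : hom (tgt a) (tgt b);
  sq_comm : sq_tgt @o arr a =~ arr b @o sq_src
}.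
Arguments Square {C a b sq_src sq_tgt} sq_comm.

Definition square_eq (C : preadd) (a b : arrow C) (s t : square a b) : Prop :=
  sq_src s =~ sq_src t /\ sq_tgt s =~ sq_tgt t.

Section Squares.
Variable C : preadd.

Fact square_id_comm (a : arrow C) : idm (tgt a) @o arr a =~ arr a @o idm (src a).
Proof. by rewrite comp_idl comp_idr. Qed.

Fact square_comp_comm (a b c : arrow C) (t : square b c) (s : square a b) :
  (sq_tgt t @o sq_tgt s) @o arr a =~ arr c @o (sq_src t @o sq_src s).
Proof. by rewrite -comp_assoc sq_comm comp_assoc sq_comm -comp_assoc. Qed.

Fact square_zero_comm (a b : arrow C) :
  zerom (tgt a) (tgt b) @o arr a =~ arr b @o zerom (src a) (src b).
Proof. by rewrite comp_zerol comp_zeror. Qed.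

Fact square_add_comm (a b : arrow C) (s t : square a b) :
  (sq_tgt s +~ sq_tgt t) @o arr a =~ arr b @o (sq_src s +~ sq_src t).
Proof. by rewrite comp_addl comp_addr !sq_comm. Qed.

Fact square_opp_comm (a b : arrow C) (s : square a b) :
  oppm (sq_tgt s) @o arr a =~ arr b @o oppm (sq_src s).
Proof. by rewrite comp_oppl comp_oppr sq_comm. Qed.

End Squares.

Program Definition arrowcat (C : preadd) : preadd :=
  @Preadd (arrow C) (@square C) (@square_eq C)
    (fun a => Square (square_id_comm a))
    (fun a b c t s => Square (square_comp_comm t s))
    (fun a b => Square (square_zero_comm a b))
    (fun a b s t => Square (square_add_comm s t))
    (fun a b s => Square (square_opp_comm s))
    _ _ _ _ _ _ _ _ _ _ _ _ _.
Next Obligation.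
move=> C a b; split=> [s|s t [e1 e2]|s t u [e1 e2] [e3 e4]]; split=> //.
- by rewrite e1.
- by rewrite e2.
- by rewrite e1.
- by rewrite e2.
Qed.
Next Obligation. by move=> C a b c ? ? ? ? [? ?] [? ?]; split; apply: comp_ext. Qed.
Next Obligation. by move=> C a b ? ? ? ? [? ?] [? ?]; split; apply: addm_ext. Qed.
Next Obligation. by move=> C a b ? ? [? ?]; split; apply: oppm_ext. Qed.
Next Obligation. by move=> *; split; apply: comp_assoc. Qed.
Next Obligation. by move=> *; split; apply: comp_idl. Qed.
Next Obligation. by move=> *; split; apply: comp_idr. Qed.
Next Obligation. by move=> *; split; apply: addm_assoc. Qed.
Next Obligation. by move=> *; split; apply: addm_comm. Qed.
Next Obligation. by move=> *; split; apply: addm_zero. Qed.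
Next Obligation. by move=> *; split; apply: addm_opp. Qed.
Next Obligation. by move=> *; split; apply: comp_addl. Qed.
Next Obligation. by move=> *; split; apply: comp_addr. Qed.

Section Notions.
Variable C : preadd.
Implicit Types X Y Z K Q : C.

Definition is_iso X Y (f : hom X Y) : Prop :=
  exists g : hom Y X, g @o f =~ idm X /\ f @o g =~ idm Y.

Definition is_mono X Y (f : hom X Y) : Prop :=
  forall W (u v : hom W X), f @o u =~ f @o v -> u =~ v.

Definition is_epi X Y (f : hom X Y) : Prop :=
  forall W (u v : hom Y W), u @o f =~ v @o f -> u =~ v.

Definition is_zero Z : Prop := idm Z =~ zerom Z Z.

Definition is_kernel X Y (f : hom X Y) K (k : hom K X) : Prop :=
  f @o k =~ zerom K Y /\
  forall W (u : hom W X), f @o u =~ zerom W Y ->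
    exists2 v : hom W K, k @o v =~ u & forall v', k @o v' =~ u -> v' =~ v.

Definition is_cokernel X Y (f : hom X Y) Q (q : hom Y Q) : Prop :=
  q @o f =~ zerom X Q /\
  forall W (u : hom Y W), u @o f =~ zerom X W ->
    exists2 v : hom Q W, v @o q =~ u & forall v', v' @o q =~ u -> v' =~ v.

Record biproduct_data X Y Z (i1 : hom X Z) (i2 : hom Y Z)
    (p1 : hom Z X) (p2 : hom Z Y) : Prop := BiproductData {
  bip11 : p1 @o i1 =~ idm X;
  bip22 : p2 @o i2 =~ idm Y;
  bip12 : p1 @o i2 =~ zerom Y X;
  bip21 : p2 @o i1 =~ zerom X Y;
  bip_id : i1 @o p1 +~ i2 @o p2 =~ idm Z
}.

Definition is_biproduct X Y Z : Prop :=
  exists i1 i2 p1 p2, @biproduct_data X Y Z i1 i2 p1 p2.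

Definition additive_cat : Prop :=
  (exists Z, is_zero Z) /\ (forall X Y, exists Z, is_biproduct X Y Z).

Record abelian_cat : Prop := AbelianCat {
  ab_additive : additive_cat;
  ab_kernel : forall X Y (f : hom X Y), exists K (k : hom K X), is_kernel f k;
  ab_cokernel : forall X Y (f : hom X Y), exists Q (q : hom Y Q), is_cokernel f q;
  ab_mono : forall X Y (f : hom X Y), is_mono f ->
    exists Z (g : hom Y Z), is_kernel g f;
  ab_epi : forall X Y (f : hom X Y), is_epi f ->
    exists Z (g : hom Z X), is_cokernel g f
}.

(* Z is isomorphic to a finite, possibly empty, direct sum of objects in K.    *)
Inductive finite_sum (K : C -> Prop) : C -> Prop :=
| finite_sum_zero Z of is_zero Z : finite_sum K Z
| finite_sum_base Z of K Z : finite_sum K Z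
| finite_sum_add X Y Z of finite_sum K X & finite_sum K Y & is_biproduct X Y Z :
    finite_sum K Z.

Definition factors_through (K : C -> Prop) X Y (f : hom X Y) : Prop :=
  exists2 Z, finite_sum K Z &
    exists (g : hom X Z) (h : hom Z Y), f =~ h @o g.

Definition right_approx (P : C -> Prop) A X (f : hom X A) : Prop :=
  P X /\ forall X' (g : hom X' A), P X' -> exists h : hom X' X, f @o h =~ g.

Definition left_approx (P : C -> Prop) A X (f : hom A X) : Prop :=
  P X /\ forall X' (g : hom A X'), P X' -> exists h : hom X X', h @o f =~ g.

Definition functorially_finite (P : C -> Prop) : Prop :=
  forall A, (exists X (f : hom X A), right_approx P f) /\
            (exists X (f : hom A X), left_approx P f).

End Notions.

(* The ideal of maps factoring through finite sums of objects in K is closed   *)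
(* under addition because C has biproducts.                                    *)
Section Quotient.
Variable C : preadd.
Variable addC : additive_cat C.
Variable K : C -> Prop.

Definition quot_eq (X Y : C) (f g : hom X Y) : Prop :=
  factors_through K (f +~ oppm g).

Lemma factors_eq (X Y : C) (f g : hom X Y) :
  f =~ g -> factors_through K f -> factors_through K g.
Proof.
by move=> e [Z KZ [u [v e']]]; exists Z => //; exists u, v; rewrite -e.
Qed.

Lemma factors_zero (X Y : C) : factors_through K (zerom X Y).
Proof.
have [[Z Z0] _] := addC; exists Z; first exact: finite_sum_zero.
by exists (zerom X Z), (zerom Z Y); rewrite comp_zeror.
Qed.

Lemma factors_opp (X Y : C) (f : hom X Y) :
  factors_through K f -> factors_through K (oppm f).
Proof.
move=> [Z KZ [u [v e]]]; exists Z => //; exists u, (oppm v).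
by rewrite e comp_oppl.
Qed.

Lemma factors_add (X Y : C) (f g : hom X Y) :
  factors_through K f -> factors_through K g -> factors_through K (f +~ g).
Proof.
move=> [Z KZ [u [v e]]] [Z' KZ' [u' [v' e']]].
have [_ /(_ Z Z')[W ZZ'W]] := addC.
exists W; first exact: finite_sum_add KZ KZ' ZZ'W.
case: ZZ'W => i1 [i2 [p1 [p2 [e11 e22 e12 e21 _]]]].
exists (i1 @o u +~ i2 @o u'), (v @o p1 +~ v' @o p2).
rewrite comp_addr !comp_addl -!comp_assoc.
rewrite !(comp_assoc p1) !(comp_assoc p2) e11 e12 e21 e22.
by rewrite !comp_idl !comp_zerol !comp_zeror addm_zeror addm_zero e e'.
Qed.

Lemma factors_compl (X Y Z : C) (g : hom Y Z) (f : hom X Y) :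
  factors_through K f -> factors_through K (g @o f).
Proof.
move=> [W KW [u [v e]]]; exists W => //; exists u, (g @o v).
by rewrite e comp_assoc.
Qed.

Lemma factors_compr (X Y Z : C) (g : hom Y Z) (f : hom X Y) :
  factors_through K g -> factors_through K (g @o f).
Proof.
move=> [W KW [u [v e]]]; exists W => //; exists (u @o f), v.
by rewrite e comp_assoc.
Qed.

Lemma heq_quot (X Y : C) (f g : hom X Y) : f =~ g -> quot_eq f g.
Proof.
by move=> e; apply: factors_eq (factors_zero X Y); rewrite e addm_oppr.
Qed.

Program Definition quotcat : preadd :=
  @Preadd C (@hom C) quot_eq (@idm C) (@comp C) (@zerom C) (@addm C) (@oppm C)
    _ _ _ _ _ _ _ _ _ _ _ _ _.
Next Obligation.
move=> X Y; split=> [f|f g fg|f g h fg gh]; first exact: heq_quot.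
- by apply: factors_eq (factors_opp fg); rewrite oppm_add oppm_opp addm_comm.
apply: factors_eq (factors_add fg gh).
by rewrite -addm_assoc (addm_assoc (oppm g)) addm_opp addm_zero.
Qed.
Next Obligation.
move=> X Y Z g g' f f' gg' ff'.
apply: factors_eq (factors_add (factors_compr f gg') (factors_compl g' ff')).
rewrite comp_addl comp_addr comp_oppl comp_oppr -addm_assoc.
by rewrite (addm_assoc (oppm _)) addm_opp addm_zero.
Qed.
Next Obligation.
move=> X Y f f' g g' ff' gg'.
by apply: factors_eq (factors_add ff' gg'); rewrite oppm_add addmACA.
Qed.
Next Obligation.
move=> X Y f f' ff'.
by apply: factors_eq (factors_opp ff'); rewrite oppm_add.
Qed.
Next Obligation. by move=> *; apply: heq_quot; apply: comp_assoc. Qed.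
Next Obligation. by move=> *; apply: heq_quot; apply: comp_idl. Qed.
Next Obligation. by move=> *; apply: heq_quot; apply: comp_idr. Qed.
Next Obligation. by move=> *; apply: heq_quot; apply: addm_assoc. Qed.
Next Obligation. by move=> *; apply: heq_quot; apply: addm_comm. Qed.
Next Obligation. by move=> *; apply: heq_quot; apply: addm_zero. Qed.
Next Obligation. by move=> *; apply: heq_quot; apply: addm_opp. Qed.
Next Obligation. by move=> *; apply: heq_quot; apply: comp_addl. Qed.
Next Obligation. by move=> *; apply: heq_quot; apply: comp_addr. Qed.

End Quotient.

Record functor (C D : preadd) := Functor {
  fob :> C -> D;
  fmap : forall X Y : C, hom X Y -> hom (fob X) (fob Y);
  fmap_ext : forall X Y (f g : hom X Y), f =~ g -> fmap f =~ fmap g;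
  fmap_id : forall X, fmap (idm X) =~ idm (fob X);
  fmap_comp : forall X Y Z (g : hom Y Z) (f : hom X Y),
    fmap (g @o f) =~ fmap g @o fmap f;
  fmap_add : forall X Y (f g : hom X Y), fmap (f +~ g) =~ fmap f +~ fmap g
}.
Arguments fmap {C D} _ {X Y} f.

Program Definition idfunctor (C : preadd) : functor C C :=
  @Functor C C (fun X => X) (fun X Y f => f) _ _ _ _.
Next Obligation. by []. Qed.
Next Obligation. by []. Qed.
Next Obligation. by []. Qed.
Next Obligation. by []. Qed.

Program Definition compfunctor (C D E : preadd) (G : functor D E)
    (F : functor C D) : functor C E :=
  @Functor C E (fun X => G (F X)) (fun X Y f => fmap G (fmap F f)) _ _ _ _.
Next Obligation. by move=> *; do 2 apply: fmap_ext. Qed.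
Next Obligation.
by move=> C D E G F X; rewrite -fmap_id; apply: fmap_ext; apply: fmap_id.
Qed.
Next Obligation.
by move=> C D E G F *; rewrite -fmap_comp; apply: fmap_ext; apply: fmap_comp.
Qed.
Next Obligation.
by move=> C D E G F *; rewrite -fmap_add; apply: fmap_ext; apply: fmap_add.
Qed.

Record nattrans (C D : preadd) (F G : functor C D) := NatTrans {
  ntr :> forall X : C, hom (F X) (G X);
  ntr_nat : forall (X Y : C) (f : hom X Y),
    ntr Y @o fmap F f =~ fmap G f @o ntr X
}.

Section NatTransOps.
Variables C D : preadd.
Implicit Types F G H : functor C D.

Definition nattrans_eq F G (a b : nattrans F G) : Prop :=
  forall X, a X =~ b X.

Program Definition nattrans_id F : nattrans F F :=
  @NatTrans C D F F (fun X => idm (F X)) _.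
Next Obligation. by move=> F X Y f; rewrite comp_idl comp_idr. Qed.

Program Definition nattrans_comp F G H (b : nattrans G H) (a : nattrans F G) :
    nattrans F H := @NatTrans C D F H (fun X => b X @o a X) _.
Next Obligation.
by move=> F G H b a X Y f; rewrite -comp_assoc ntr_nat comp_assoc ntr_nat -comp_assoc.
Qed.

Program Definition nattrans_zero F G : nattrans F G :=
  @NatTrans C D F G (fun X => zerom (F X) (G X)) _.
Next Obligation. by move=> F G X Y f; rewrite comp_zerol comp_zeror. Qed.

Program Definition nattrans_add F G (a b : nattrans F G) : nattrans F G :=
  @NatTrans C D F G (fun X => a X +~ b X) _.
Next Obligation. by move=> F G a b X Y f; rewrite comp_addl comp_addr !ntr_nat. Qed.

Program Definition nattrans_opp F G (a : nattrans F G) : nattrans F G :=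
  @NatTrans C D F G (fun X => oppm (a X)) _.
Next Obligation. by move=> F G a X Y f; rewrite comp_oppl comp_oppr ntr_nat. Qed.

End NatTransOps.

Program Definition functorcat (C D : preadd) : preadd :=
  @Preadd (functor C D) (@nattrans C D) (@nattrans_eq C D) (@nattrans_id C D)
    (@nattrans_comp C D) (@nattrans_zero C D) (@nattrans_add C D)
    (@nattrans_opp C D) _ _ _ _ _ _ _ _ _ _ _ _ _.
Next Obligation.
move=> C D F G; split=> [a X|a b ab X|a b c ab bc X] //; first by rewrite ab.
by rewrite ab.
Qed.
Next Obligation. by move=> C D F G H b b' a a' bb' aa' X; apply: comp_ext. Qed.
Next Obligation. by move=> C D F G a a' b b' aa' bb' X; apply: addm_ext. Qed.
Next Obligation. by move=> C D F G a a' aa' X; apply: oppm_ext. Qed.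
Next Obligation. by move=> *; move=> X; apply: comp_assoc. Qed.
Next Obligation. by move=> *; move=> X; apply: comp_idl. Qed.
Next Obligation. by move=> *; move=> X; apply: comp_idr. Qed.
Next Obligation. by move=> *; move=> X; apply: addm_assoc. Qed.
Next Obligation. by move=> *; move=> X; apply: addm_comm. Qed.
Next Obligation. by move=> *; move=> X; apply: addm_zero. Qed.
Next Obligation. by move=> *; move=> X; apply: addm_opp. Qed.
Next Obligation. by move=> *; move=> X; apply: comp_addl. Qed.
Next Obligation. by move=> *; move=> X; apply: comp_addr. Qed.

Definition naturally_isomorphic (C D : preadd) (F G : functor C D) : Prop :=
  exists a : nattrans F G, forall X, is_iso (a X).

Definition equivalent_cat (C D : preadd) : Prop :=
  exists (F : functor C D) (G : functor D C),
    naturally_isomorphic (compfunctor G F) (idfunctor C) /\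
    naturally_isomorphic (compfunctor F G) (idfunctor D).

Program Definition Abcat : preadd :=
  @Preadd zmodType (fun A B => {additive A -> B}) (fun A B f g => f =1 g)
    (fun A => idfun) (fun A B C g f => g \o f) (fun A B => \0)
    (fun A B f g => f \+ g) (fun A B f => \- f)
    _ _ _ _ _ _ _ _ _ _ _ _ _.
Next Obligation.
by move=> A B; split=> [f|f g e|f g h e1 e2] x; rewrite ?e ?e1.
Qed.
Next Obligation. by move=> A B C g g' f f' eg ef x /=; rewrite ef eg. Qed.
Next Obligation. by move=> A B f f' g g' ef eg x /=; rewrite ef eg. Qed.
Next Obligation. by move=> A B f f' ef x /=; rewrite ef. Qed.
Next Obligation. by []. Qed.
Next Obligation. by []. Qed.
Next Obligation. by []. Qed.
Next Obligation. by move=> A B f g h x /=; rewrite addrA. Qed.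
Next Obligation. by move=> A B f g x /=; rewrite addrC. Qed.
Next Obligation. by move=> A B f x /=; rewrite add0r. Qed.
Next Obligation. by move=> A B f x /=; rewrite addNr. Qed.
Next Obligation. by []. Qed.
Next Obligation. by move=> A B C g f f' x /=; rewrite raddfD. Qed.

(* Modules are left modules; right L-modules are the left modules over the     *)
(* converse ring L^c.                                                          *)
Section Modules.
Variable L : pzRingType.

Definition finitely_generated (A : lmodType L) : Prop :=
  exists n (g : 'I_n -> A), forall x, exists c : 'I_n -> L,
    x = \sum_(i < n) c i *: g i.

Definition projective (P : lmodType L) : Prop :=
  forall (X Y : lmodType L) (g : {linear X -> Y}) (f : {linear P -> Y}),
    (forall y, exists x, g x = y) ->
    exists h : {linear P -> X}, g \o h =1 f.

Definition injective_module (I : lmodType L) : Prop :=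
  forall (X Y : lmodType L) (g : {linear X -> Y}) (f : {linear X -> I}),
    injective g -> exists h : {linear Y -> I}, h \o g =1 f.

Record projective_resolution (A : lmodType L) := ProjectiveResolution {
  res :> nat -> lmodType L;
  res_d : forall i, {linear res i.+1 -> res i};
  res_aug : {linear res 0 -> A};
  res_proj : forall i, projective (res i);
  res_surj : forall x, exists y, res_aug y = x;
  res_exact0 : forall y, res_aug y = 0 <-> exists z, res_d 0 z = y;
  res_exact : forall i y, res_d i y = 0 <-> exists z, res_d i.+1 z = y
}.

(* Ext^i(A, B) = 0: in the complex Hom(P, B), P a projective resolution of A,  *)
(* every cocycle of degree i > 0 is a coboundary.  This does not depend on P,  *)
(* and every module has a projective (even free) resolution.                   *)
Definition Ext_vanishes (i : nat) (A B : lmodType L) : Prop :=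
  match i with
  | 0 => forall f : {linear A -> B}, f =1 \0
  | j.+1 => forall (P : projective_resolution A) (f : {linear P j.+1 -> B}),
      f \o res_d P j.+1 =1 \0 ->
      exists g : {linear P j -> B}, g \o res_d P j =1 f
  end.

Record fgmod := FgMod {
  fgmod_sort :> lmodType L;
  fgmodP : finitely_generated fgmod_sort
}.

Program Definition modcat : preadd :=
  @Preadd fgmod (fun A B => {linear A -> B}) (fun A B f g => f =1 g)
    (fun A => idfun) (fun A B C g f => g \o f) (fun A B => \0)
    (fun A B f g => f \+ g) (fun A B f => \- f)
    _ _ _ _ _ _ _ _ _ _ _ _ _.
Next Obligation.
by move=> A B; split=> [f|f g e|f g h e1 e2] x; rewrite ?e ?e1.
Qed.
Next Obligation. by move=> A B C g g' f f' eg ef x /=; rewrite ef eg. Qed.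
Next Obligation. by move=> A B f f' g g' ef eg x /=; rewrite ef eg. Qed.
Next Obligation. by move=> A B f f' ef x /=; rewrite ef. Qed.
Next Obligation. by []. Qed.
Next Obligation. by []. Qed.
Next Obligation. by []. Qed.
Next Obligation. by move=> A B f g h x /=; rewrite addrA. Qed.
Next Obligation. by move=> A B f g x /=; rewrite addrC. Qed.
Next Obligation. by move=> A B f x /=; rewrite add0r. Qed.
Next Obligation. by move=> A B f x /=; rewrite addNr. Qed.
Next Obligation. by []. Qed.
Next Obligation. by move=> A B C g f f' x /=; rewrite raddfD. Qed.

End Modules.

(* Descending chain condition on the ideals, i.e. on the submodules of R^o.    *)
Definition artinian (R : comPzRingType) : Prop :=
  forall I : nat -> {pred R^o},
    (forall n, submod_closed (I n)) ->
    (forall n, {subset I n.+1 <= I n}) ->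
    exists N, forall n, (N <= n)%N -> I n =i I N.

(* An R-algebra structure on L is a ring morphism u from R to the center of L; *)
(* unlike [algType R], this allows L to be the zero ring.                      *)
Definition artin_algebra (L : pzRingType) : Prop :=
  exists (R : comPzRingType) (u : {rmorphism R -> L}),
    [/\ artinian R,
        forall r x, u r * x = x * u r &
        exists n (g : 'I_n -> L), forall x, exists c : 'I_n -> R,
          x = \sum_(i < n) u (c i) * g i].

Definition self_injective (L : pzRingType) : Prop := injective_module L^o.

(* Maps equal pointwise are equal (functional extensionality), so the linear   *)
(* maps X -> Y form a zmodType and Hom(-, Y) takes its values in [Abcat].      *)
Definition linhom (L : pzRingType) (X Y : lmodType L) := {linear X -> Y}.

Section LinHom.
Variables (L : pzRingType) (X Y : lmodType L).
Implicit Types f g h : linhom X Y.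

Lemma linhom_ext f g : f =1 g -> f = g.
Proof.
case: f g => [f [[fa] [fs]]] [g [[ga] [gs]]] /= /funext fg.
case: _ / fg ga gs => ga gs.
by rewrite (Prop_irrelevance fa ga) (Prop_irrelevance fs gs).
Qed.

HB.instance Definition _ := gen_eqMixin (linhom X Y).
HB.instance Definition _ := gen_choiceMixin (linhom X Y).

Definition linhom_zero : linhom X Y := \0.
Definition linhom_add f g : linhom X Y := f \+ g.
Definition linhom_opp f : linhom X Y := \- f.

Fact linhom_addA : associative linhom_add.
Proof. by move=> f g h; apply: linhom_ext => x /=; rewrite addrA. Qed.
Fact linhom_addC : commutative linhom_add.
Proof. by move=> f g; apply: linhom_ext => x /=; rewrite addrC. Qed.
Fact linhom_add0 : left_id linhom_zero linhom_add.
Proof. by move=> f; apply: linhom_ext => x /=; rewrite add0r. Qed.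
Fact linhom_addN : left_inverse linhom_zero linhom_opp linhom_add.
Proof. by move=> f; apply: linhom_ext => x /=; rewrite addNr. Qed.

HB.instance Definition _ := GRing.isZmodule.Build (linhom X Y)
  linhom_addA linhom_addC linhom_add0 linhom_addN.
End LinHom.

Section Precompose.
Variables (L : pzRingType) (X Y Z : lmodType L) (f : {linear X -> Y}).

Definition precomp (g : linhom Y Z) : linhom X Z := g \o f.

Fact precomp_is_additive : zmod_morphism precomp.
Proof. by move=> g h; apply: linhom_ext. Qed.

HB.instance Definition _ :=
  GRing.isZmodMorphism.Build (linhom Y Z) (linhom X Z) precomp
    precomp_is_additive.
End Precompose.

Section Subcategory.
Variables (L : pzRingType) (M : modcat L -> Prop).

Definition subcat : preadd := fullsub M.

Definition modof (X : subcat) : fgmod L := sval X.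
Definition mapof (X Y : subcat) (f : hom X Y) : {linear modof X -> modof Y} := f.

Record cluster_tilting (n : nat) : Prop := ClusterTilting {
  ct_additive : additive_cat subcat;
  ct_ffinite : functorially_finite M;
  ct_generating : forall A : fgmod L, exists X : fgmod L,
    M X /\ exists f : {linear X -> A}, forall a, exists x, f x = a;
  ct_cogenerating : forall A : fgmod L, exists X : fgmod L,
    M X /\ exists f : {linear A -> X}, injective f;
  ct_right : forall A : fgmod L, M A <->
    forall X : fgmod L, M X -> forall i, (0 < i < n)%N -> Ext_vanishes i X A;
  ct_left : forall A : fgmod L, M A <->
    forall X : fgmod L, M X -> forall i, (0 < i < n)%N -> Ext_vanishes i A X
}.

Definition Modcat : preadd := functorcat (opcat subcat) Abcat.

Program Definition representable (Y : subcat) : Modcat :=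
  @Functor (opcat subcat) Abcat (fun X => linhom (modof X) (modof Y) : zmodType)
    (fun X X' f => precomp (mapof f)) _ _ _ _.
Next Obligation.
by move=> Y X X' f f' e g; apply: linhom_ext => x /=; congr (g _); apply: e.
Qed.
Next Obligation. by move=> Y X g; apply: linhom_ext. Qed.
Next Obligation. by move=> Y X X' X'' f f' g; apply: linhom_ext. Qed.
Next Obligation.
by move=> Y X X' f f' g; apply: linhom_ext => x /=; rewrite raddfD.
Qed.

Definition value (F : Modcat) (X : subcat) : zmodType := fob F X.
Definition component (F G : Modcat) (a : hom F G) (X : subcat) :
  {additive value F X -> value G X} := ntr a X.

(* Hom(-, X) -> Hom(-, Y) -> F -> 0 is exact; exactness in a category of       *)
(* functors to abelian groups is computed pointwise.                           *)
Definition finitely_presented (F : Modcat) : Prop :=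
  exists (X Y : subcat) (a : hom (representable X) (representable Y))
         (e : hom (representable Y) F), forall Z : subcat,
    (forall x, exists y, component e Z y = x) /\
    (forall y, component e Z y = 0 <-> exists x, component a Z x = y).

Definition vanishes_on_projectives (F : Modcat) : Prop :=
  forall P : subcat, projective (modof P) -> forall x : value F P, x = 0.

Definition stable_modcat : preadd :=
  fullsub (fun F : Modcat => finitely_presented F /\ vanishes_on_projectives F).

Definition monocat : preadd :=
  fullsub (fun a : arrowcat subcat => injective (mapof (arr a))).

Inductive ideal_generator : arrow subcat -> Prop :=
| generator_id (X : subcat) : ideal_generator (Arrow (idm X))
| generator_proj (X P : subcat) (f : hom X P) of projective (modof P) :
    ideal_generator (Arrow f).

Definition Ugen (a : monocat) : Prop := ideal_generator (sval a).

Lemma monocat_additive : additive_cat subcat -> additive_cat monocat.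
Proof.
move=> [[Z Z0] biP]; split.
  have inj0 : injective (mapof (idm Z)) by [].
  by exists (exist _ (Arrow (idm Z) : arrowcat subcat) inj0); split; apply: Z0.
move=> [a a_inj] [b b_inj].
have [S [i1 [i2 [p1 [p2 [s11 s22 s12 s21 s_id]]]]]] := biP (src a) (src b).
have [T [j1 [j2 [q1 [q2 [t11 t22 t12 t21 t_id]]]]]] := biP (tgt a) (tgt b).
pose c : hom S T := j1 @o arr a @o p1 +~ j2 @o arr b @o p2.
have c1 : q1 @o c =~ arr a @o p1.
  rewrite /c comp_addr -!comp_assoc !(comp_assoc q1) t11 t12.
  by rewrite comp_idl comp_zerol addm_zeror.
have c2 : q2 @o c =~ arr b @o p2.
  rewrite /c comp_addr -!comp_assoc !(comp_assoc q2) t21 t22.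
  by rewrite comp_idl comp_zerol addm_zero.
have c3 : j1 @o arr a =~ c @o i1.
  rewrite /c comp_addl -!comp_assoc s11 s21.
  by rewrite !comp_zeror comp_idr addm_zeror.
have c4 : j2 @o arr b =~ c @o i2.
  rewrite /c comp_addl -!comp_assoc s12 s22.
  by rewrite !comp_zeror comp_idr addm_zero.
have c_inj : injective (mapof c).
  move=> x y xy.
  have e1 : mapof p1 x = mapof p1 y.
    apply: a_inj; apply: etrans (esym (c1 x : _ = _)) (etrans _ (c1 y : _ = _)).
    exact: (congr1 (mapof q1) xy).
  have e2 : mapof p2 x = mapof p2 y.
    apply: b_inj; apply: etrans (esym (c2 x : _ = _)) (etrans _ (c2 y : _ = _)).
    exact: (congr1 (mapof q2) xy).
  apply: etrans (esym (s_id x : _ = _)) (etrans _ (s_id y : _ = _)).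
  exact: (congr2 +%R (congr1 (mapof i1) e1) (congr1 (mapof i2) e2)).
exists (exist _ (Arrow c : arrowcat subcat) c_inj).
exists (@Square subcat a (Arrow c) i1 j1 c3), (@Square subcat b (Arrow c) i2 j2 c4),
  (@Square subcat (Arrow c) a p1 q1 c1), (@Square subcat (Arrow c) b p2 q2 c2).
by split; split.
Qed.

End Subcategory.

(* Main.v *)
(* To a monomorphism f : M1 -> M2 in M attach Psi(f), the cokernel of the map
   Hom(-, M1) -> Hom(-, M2) of stable Hom-functors.
   - Psi is dense.  A finitely presented functor vanishing on projectives is the
     cokernel of Hom(-, a) for a surjective a : X -> Y; if i embeds X into a
     projective Q, it is Psi(f) for f = (a, i) : X -> Y + Q.
   - Psi is full.  A map Psi(f) -> Psi(f') is induced by some b : M2 -> M2' such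
     that b f - f' c factors through a projective P; as P is injective and f is
     mono, M1 -> P extends to M2, and b can be corrected so that (c, b) commutes.
   - If Psi(c, b) = 0, then b = f' h + w i where i embeds M2 in a projective Q, so
     (c, b) is the sum of (h f, f' h), which factors through (M2 = M2), and of
     (c - h f, w i), which factors through i f : M1 -> Q.
   The target is abelian because M has weak pullbacks: take a right
   M-approximation of the pullback of modules.
   What is used about the algebra is that finitely generated modules embed into
   free ones and have finitely generated submodules; both follow from the fact
   that every simple left module embeds into a left self-injective, left artinian
   ring. *)
From HB Require Import structures.
From mathcomp Require Import all_boot all_algebra.
From mathcomp Require Import boolp classical_sets.
From Stdlib Require Import Setoid Morphisms.
Require Import Defs.

Set Implicit Arguments.
Unset Strict Implicit.
Unset Printing Implicit Defensive.

Import GRing.Theory.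
Local Open Scope ring_scope.
Local Open Scope cat_scope.
#[local] Obligation Tactic := idtac.

(** * Additive functors, equivalences and quotient categories *)

#[export] Instance fmap_proper (C D : preadd) (F : functor C D) (X Y : C) :
  Proper (heq ==> heq) (@fmap C D F X Y).
Proof. by move=> f g; apply: fmap_ext. Qed.

Section FunctorTheory.
Variables (C D : preadd) (F : functor C D).

Lemma fmap_zero (X Y : C) : fmap F (zerom X Y) =~ zerom (F X) (F Y).
Proof.
by apply: (@addm_cancel _ _ _ _ (fmap F (zerom X Y))); rewrite -fmap_add addm_zero.
Qed.

Lemma fmap_opp (X Y : C) (f : hom X Y) : fmap F (oppm f) =~ oppm (fmap F f).
Proof. by apply: addm_uniq; rewrite -fmap_add addm_opp fmap_zero. Qed.

Lemma fmap_is_zero (X : C) : is_zero X -> is_zero (F X).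
Proof. by rewrite /is_zero => e; rewrite -fmap_id e fmap_zero. Qed.

Lemma fmap_biproduct (X Y Z : C) i1 i2 p1 p2 :
  @biproduct_data C X Y Z i1 i2 p1 p2 ->
  biproduct_data (fmap F i1) (fmap F i2) (fmap F p1) (fmap F p2).
Proof.
move=> [e1 e2 e3 e4 e5]; split; rewrite -!fmap_comp.
- by rewrite e1 fmap_id.
- by rewrite e2 fmap_id.
- by rewrite e3 fmap_zero.
- by rewrite e4 fmap_zero.
- by rewrite -fmap_add e5 fmap_id.
Qed.

Definition full := forall (X Y : C) (g : hom (F X) (F Y)), exists f, fmap F f =~ g.
Definition faithful :=
  forall (X Y : C) (f g : hom X Y), fmap F f =~ fmap F g -> f =~ g.
Definition dense := forall Y : D, exists X (i : hom (F X) Y), is_iso i.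

(** Zero objects and biproducts are given by equations, so additive functors preserve them; density
    then allows moving them along isomorphisms to arbitrary objects of D. *)
Lemma additive_dense : dense -> additive_cat C -> additive_cat D.
Proof.
move=> dn [[Z Z0] bip]; split.
  by exists (F Z); apply: fmap_is_zero.
move=> X Y; have [X' [u [u' [uu' u'u]]]] := dn X; have [Y' [v [v' [vv' v'v]]]] := dn Y.
have [W [i1 [i2 [p1 [p2 /fmap_biproduct[e1 e2 e3 e4 e5]]]]]] := bip X' Y'.
exists (F W), (fmap F i1 @o u'), (fmap F i2 @o v'), (u @o fmap F p1), (v @o fmap F p2).
split.
- by rewrite -comp_assoc (comp_assoc (fmap F p1)) e1 comp_idl.
- by rewrite -comp_assoc (comp_assoc (fmap F p2)) e2 comp_idl.
- by rewrite -comp_assoc (comp_assoc (fmap F p1)) e3 comp_zerol comp_zeror.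
- by rewrite -comp_assoc (comp_assoc (fmap F p2)) e4 comp_zerol comp_zeror.
- rewrite -!comp_assoc (comp_assoc u') (comp_assoc v') uu' vv'.
  by rewrite !comp_idl e5.
Qed.

(** The quasi-inverse chooses an object [ob Y] with an isomorphism [i Y] to Y, and sends g to a
    preimage under F of its conjugate by these isomorphisms. Faithfulness lets the functor laws be
    checked after applying F. *)
Lemma equivalent_ff : full -> faithful -> dense -> equivalent_cat C D.
Proof.
move=> fu fa dn.
pose ob Y : C := sval (cid (dn Y)).
pose i Y : hom (F (ob Y)) Y := sval (cid (svalP (cid (dn Y)))).
pose iP Y : is_iso (i Y) := svalP (cid (svalP (cid (dn Y)))).
pose j Y : hom Y (F (ob Y)) := sval (cid (iP Y)).
have ji Y : j Y @o i Y =~ idm _ by rewrite /j; case: (cid (iP Y)) => ? [].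
have ij Y : i Y @o j Y =~ idm _ by rewrite /j; case: (cid (iP Y)) => ? [].
pose gm (Y Y' : D) (g : hom Y Y') : hom (ob Y) (ob Y') :=
  sval (cid (fu _ _ (j Y' @o g @o i Y))).
have gmE (Y Y' : D) (g : hom Y Y') : fmap F (gm _ _ g) =~ j Y' @o g @o i Y.
  by rewrite /gm; case: (cid _).
have h1 (X Y : D) (f g : hom X Y) : f =~ g -> gm _ _ f =~ gm _ _ g.
  by move=> e; apply: fa; rewrite !gmE e.
have h2 (X : D) : gm _ _ (idm X) =~ idm _.
  by apply: fa; rewrite gmE comp_idr ji fmap_id.
have h3 (X Y Z : D) (g : hom Y Z) (f : hom X Y) :
    gm _ _ (g @o f) =~ gm _ _ g @o gm _ _ f.
  apply: fa; rewrite fmap_comp !gmE -!comp_assoc.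
  by rewrite (comp_assoc (i Y)) ij comp_idl.
have h4 (X Y : D) (f g : hom X Y) : gm _ _ (f +~ g) =~ gm _ _ f +~ gm _ _ g.
  by apply: fa; rewrite fmap_add !gmE comp_addr comp_addl.
pose G := @Functor D C ob gm h1 h2 h3 h4.
exists F, G; split.
- pose e X : hom (ob (F X)) X := sval (cid (fu _ _ (i (F X)))).
  have eE X : fmap F (e X) =~ i (F X) by rewrite /e; case: (cid _).
  have en (X Y : C) (f : hom X Y) : e Y @o gm _ _ (fmap F f) =~ f @o e X.
    apply: fa; rewrite !fmap_comp !eE gmE.
    by rewrite !comp_assoc ij comp_idl.
  exists (@NatTrans C C (compfunctor G F) (idfunctor C) e en) => X /=.
  have [k kE] := fu _ _ (j (F X)).
  exists k; split; apply: fa; rewrite fmap_comp fmap_id eE kE; [exact: ji|exact: ij].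
- have en (X Y : D) (f : hom X Y) : i Y @o fmap F (gm _ _ f) =~ f @o i X.
    by rewrite gmE !comp_assoc ij comp_idl.
  by exists (@NatTrans D D (compfunctor F G) (idfunctor D) i en) => X /=.
Qed.

End FunctorTheory.

Program Definition opfunctor (C D : preadd) (F : functor C D) :
    functor (opcat C) (opcat D) :=
  @Functor (opcat C) (opcat D) F (fun X Y f => fmap F f) _ _ _ _.
Next Obligation. by move=> C D F X Y; exact: (@fmap_ext C D F Y X). Qed.
Next Obligation. by move=> C D F; exact: (@fmap_id C D F). Qed.
Next Obligation. by move=> C D F X Y Z g f; exact: (@fmap_comp C D F Z Y X f g). Qed.
Next Obligation. by move=> C D F X Y; exact: (@fmap_add C D F Y X). Qed.

Lemma opfunctor_dense (C D : preadd) (F : functor C D) :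
  dense F -> dense (opfunctor F).
Proof.
by move=> dn Y; have [X [i [j [e1 e2]]]] := dn Y; exists X, j; exists i.
Qed.

(** * Transfer of abelian structure along an equivalence *)

Section FullyFaithful.
Variables (C D : preadd) (F : functor C D).
Hypotheses (fu : full F) (fa : faithful F) (dn : dense F).

Lemma ff_reflect_kernel (X Y K : C) (f : hom X Y) (k : hom K X) :
  is_kernel (fmap F f) (fmap F k) -> is_kernel f k.
Proof.
move=> [k0 ku]; split; first by apply: fa; rewrite fmap_comp k0 fmap_zero.
move=> W u fu0.
have [|v vE vu] := ku (F W) (fmap F u); first by rewrite -fmap_comp fu0 fmap_zero.
have [w wE] := fu v; exists w; first by apply: fa; rewrite fmap_comp wE vE.
by move=> w' w'E; apply: fa; rewrite wE; apply: vu; rewrite -fmap_comp w'E.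
Qed.

Lemma kernel_comp_iso (X Y K K' : D) (f : hom X Y) (k : hom K X) (i : hom K' K) :
  is_iso i -> is_kernel f k -> is_kernel f (k @o i).
Proof.
move=> [j [ji ij]] [k0 ku]; split; first by rewrite comp_assoc k0 comp_zerol.
move=> W u /ku[v vE vu]; exists (j @o v).
  by rewrite -comp_assoc (comp_assoc i) ij comp_idl.
move=> v' v'E; rewrite -(vu (i @o v')) ?comp_assoc ?ji ?comp_idl //.
Qed.

Lemma kernel_iso_comp (X Y Y' K : D) (f : hom X Y) (k : hom K X) (i : hom Y Y') :
  is_iso i -> is_kernel f k -> is_kernel (i @o f) k.
Proof.
move=> [j [ji ij]] [k0 ku]; split; first by rewrite -comp_assoc k0 comp_zeror.
move=> W u e; apply: ku.
by rewrite -(comp_idl (f @o u)) -ji -comp_assoc (comp_assoc i) e comp_zeror.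
Qed.

Lemma kernel_ext (X Y K : D) (f f' : hom X Y) (k k' : hom K X) :
  f =~ f' -> k =~ k' -> is_kernel f k -> is_kernel f' k'.
Proof.
move=> ef ek [k0 ku]; split; first by rewrite -ef -ek.
move=> W u; rewrite -ef => /ku[v vE vu]; exists v; first by rewrite -ek.
by move=> v'; rewrite -ek; apply: vu.
Qed.

Lemma ff_kernels :
  (forall (X Y : D) (f : hom X Y), exists K (k : hom K X), is_kernel f k) ->
  forall (X Y : C) (f : hom X Y), exists K (k : hom K X), is_kernel f k.
Proof.
move=> kerD X Y f; have [K [k kf]] := kerD _ _ (fmap F f).
have [K' [i iP]] := dn K; have [k' k'E] := fu (k @o i).
exists K', k'; apply: ff_reflect_kernel.
by apply: kernel_ext (kernel_comp_iso iP kf); rewrite ?k'E.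
Qed.

(** By density every test object W is isomorphic to some F W', and fullness lifts the test maps to
    C. *)
Lemma ff_mono (X Y : C) (f : hom X Y) : is_mono f -> is_mono (fmap F f).
Proof.
move=> fm W u v e; have [W' [i [j [ji ij]]]] := dn W.
have [u' u'E] := fu (u @o i); have [v' v'E] := fu (v @o i).
have uv : u' =~ v'.
  by apply: fm; apply: fa; rewrite !fmap_comp u'E v'E !comp_assoc e.
rewrite -(comp_idr u) -(comp_idr v) -ij !comp_assoc.
by rewrite -u'E -v'E uv.
Qed.

Lemma ff_normal_mono :
  (forall (X Y : D) (f : hom X Y), is_mono f -> exists Z (g : hom Y Z), is_kernel g f) ->
  forall (X Y : C) (f : hom X Y), is_mono f -> exists Z (g : hom Y Z), is_kernel g f.
Proof.
move=> nD X Y f /ff_mono/nD[Z [g gP]].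
have [Z' [i [j [ji ij]]]] := dn Z; have [g' g'E] := fu (j @o g).
exists Z', g'; apply: ff_reflect_kernel.
have jP : is_iso j by exists i.
by apply: kernel_ext (kernel_iso_comp jP gP); rewrite ?g'E.
Qed.

End FullyFaithful.

(** The axioms on kernels and monomorphisms are reflected by F; those on cokernels and epimorphisms
    are the same statements for [opfunctor F]. *)
Lemma abelian_ff (C D : preadd) (F : functor C D) :
  full F -> faithful F -> dense F -> additive_cat C -> abelian_cat D -> abelian_cat C.
Proof.
move=> fu fa dn addC [_ kerD cokD nmD neD].
have fuo : full (opfunctor F) by move=> X Y; apply: fu.
have fao : faithful (opfunctor F) by move=> X Y; apply: fa.
have dno := opfunctor_dense dn; split=> //.
- exact: ff_kernels fu fa dn kerD.
- by move=> X Y; apply: (ff_kernels fuo fao dno (fun X Y => cokD Y X)).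
- exact: ff_normal_mono fu fa dn nmD.
- by move=> X Y; apply: (ff_normal_mono fuo fao dno (fun X Y => neD Y X)).
Qed.

(** * Functors induced on quotient categories *)

Section QuotientFunctor.
Variables (C D : preadd) (addC : additive_cat C) (K : C -> Prop) (F : functor C D).
Hypothesis FK : forall X, K X -> is_zero (F X).

Lemma finite_sum_is_zero X : finite_sum K X -> is_zero (F X).
Proof.
elim=> [Z /fmap_is_zero//|Z /FK//|X1 X2 Z _ h1 _ h2].
move=> [i1 [i2 [p1 [p2 /(fmap_biproduct F)[_ _ _ _ e]]]]].
rewrite /is_zero -e -(comp_idr (fmap F i1)) -(comp_idr (fmap F i2)) h1 h2.
by rewrite !comp_zeror !comp_zerol addm_zero.
Qed.

Lemma fmap_quot (X Y : C) (f g : hom X Y) :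
  quot_eq K f g -> fmap F f =~ fmap F g.
Proof.
move=> [Z /finite_sum_is_zero Z0 [u [v e]]].
have e0 : fmap F (f +~ oppm g) =~ zerom _ _.
  by rewrite e fmap_comp -(comp_idl (fmap F u)) Z0 comp_zerol comp_zeror.
rewrite -(oppm_opp (fmap F g)) -fmap_opp; apply: addm_uniq.
by rewrite -fmap_add.
Qed.

Program Definition quotfunctor : functor (quotcat addC K) D :=
  @Functor (quotcat addC K) D F (fun X Y f => fmap F f) _ _ _ _.
Next Obligation. by move=> X Y f g; apply: fmap_quot. Qed.
Next Obligation. by move=> X; apply: fmap_id. Qed.
Next Obligation. by move=> X Y Z g f; apply: fmap_comp. Qed.
Next Obligation. by move=> X Y f g; apply: fmap_add. Qed.

End QuotientFunctor.

(** The projection from C is the identity on objects, hence dense, and [additive_dense] applies. *)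
Lemma quotcat_additive (C : preadd) (addC : additive_cat C) (K : C -> Prop) :
  additive_cat (quotcat addC K).
Proof.
have hq (X Y : C) (f g : hom X Y) : f =~ g -> @heq (quotcat addC K) X Y f g.
  exact: heq_quot.
pose F := @Functor C (quotcat addC K) (fun X => X) (fun X Y f => f) hq
  (fun X => heq_refl _) (fun X Y Z g f => heq_refl _) (fun X Y f g => heq_refl _).
apply: (@additive_dense _ _ F _ addC) => X; exists X, (idm X), (idm X).
by split; rewrite comp_idl.
Qed.

(** * Functors with values in abelian groups *)

Section Subgroups.
Variables (A : zmodType) (N : A -> Prop).

Definition subgroup : Prop := N 0 /\ forall x y, N x -> N y -> N (x - y).

(** The [Prop]-valued N is made boolean so that subtypes and quotients can be formed; carrying the
    proof of [subgroup] lets the closure instance be attached. *)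
Definition subg_pred of subgroup : {pred A} := fun x => `[< N x >].

Fact subg_closed (sN : subgroup) : zmod_closed (subg_pred sN).
Proof.
by case: sN => N0 NB; split=> [|x y /asboolP ? /asboolP ?]; apply/asboolP => //; apply: NB.
Qed.

HB.instance Definition _ (sN : subgroup) :=
  GRing.isZmodClosed.Build A (subg_pred sN) (subg_closed sN).

Record subg_type (sN : subgroup) :=
  Subg { subg_val : A; subg_valP : subg_val \in subg_pred sN }.

HB.instance Definition _ (sN : subgroup) := [isSub for @subg_val sN].
HB.instance Definition _ (sN : subgroup) := [Choice of subg_type sN by <:].
HB.instance Definition _ (sN : subgroup) :=
  [SubChoice_isSubZmodule of subg_type sN by <:].

Lemma subgroup_type : subgroup ->
  exists (S : zmodType) (i : {additive S -> A}),
    injective i /\ forall x, N x <-> exists y, i y = x.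
Proof.
move=> sN; exists (subg_type sN), val; split; first exact: val_inj.
move=> x; split=> [Nx|[y <-]]; last exact: (asboolW (valP y)).
by exists (Subg (introT (asboolP _) Nx : x \in subg_pred sN)).
Qed.

Lemma quotient_type : subgroup ->
  exists (Q : zmodType) (q : {additive A -> Q}),
    (forall y, exists x, q x = y) /\ forall x, q x = 0 <-> N x.
Proof.
move=> sN; pose I : zmodClosed A := subg_pred sN.
exists (Quotient.quot I), \pi_(Quotient.quot I)%qT; split=> [y|x].
  by exists (repr y); exact: reprK.
have e : (\pi_(Quotient.quot I)%qT x == \pi_(Quotient.quot I)%qT 0) = (x \in subg_pred sN).
  by rewrite -Quotient.idealrBE subr0.
have e0 : \pi_(Quotient.quot I)%qT 0 = 0 := raddf0 _.
by rewrite -e0; split=> [/eqP|Nx]; [rewrite e => /asboolP | apply/eqP; rewrite e; apply/asboolP].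
Qed.

End Subgroups.

Lemma additive_fun_exists (A B : zmodType) (f : A -> B) :
  (forall x y, f (x - y) = f x - f y) ->
  exists g : {additive A -> B}, forall x, g x = f x.
Proof.
move=> fB.
by exists (HB.pack f (GRing.isZmodMorphism.Build A B f fB) : {additive A -> B}).
Qed.

Section AbFunctors.
Variable C : preadd.
Local Notation FC := (functorcat C Abcat).
Implicit Types (F G H : FC) (X Y Z : C).

Definition fval F X : zmodType := fob F X.
Definition fact F X Y (f : hom X Y) : {additive fval F X -> fval F Y} := fmap F f.
Definition fcomp F G (a : hom F G) X : {additive fval F X -> fval G X} := ntr a X.

Lemma fact_id F X x : fact F (idm X) x = x.
Proof. exact: (fmap_id F X x). Qed.

Lemma fact_comp F X Y Z (g : hom Y Z) (f : hom X Y) x :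
  fact F (g @o f) x = fact F g (fact F f x).
Proof. exact: (fmap_comp F g f x). Qed.

Lemma fact_add F X Y (f g : hom X Y) x :
  fact F (f +~ g) x = fact F f x + fact F g x.
Proof. exact: (fmap_add F f g x). Qed.

Lemma fact_ext F X Y (f g : hom X Y) x : f =~ g -> fact F f x = fact F g x.
Proof. by move=> e; exact: (fmap_ext F e x). Qed.

Lemma fcomp_nat F G (a : hom F G) X Y (f : hom X Y) x :
  fcomp a Y (fact F f x) = fact G f (fcomp a X x).
Proof. exact: (ntr_nat a f x). Qed.

Lemma fcomp_comp F G H (b : hom G H) (a : hom F G) X x :
  fcomp (b @o a) X x = fcomp b X (fcomp a X x).
Proof. by []. Qed.

Lemma fcomp_ext F G (a b : hom F G) : (forall X x, fcomp a X x = fcomp b X x) -> a =~ b.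
Proof. by move=> e X x; apply: e. Qed.

Lemma fcomp_eq F G (a b : hom F G) X x : a =~ b -> fcomp a X x = fcomp b X x.
Proof. by move=> e; exact: (e X x). Qed.

Definition pointwise_inj F G (a : hom F G) := forall X, injective (fcomp a X).
Definition pointwise_surj F G (a : hom F G) :=
  forall X y, exists x, fcomp a X x = y.

Lemma nattrans_exists F G (a : forall X, fval F X -> fval G X) :
  (forall X x y, a X (x - y) = a X x - a X y) ->
  (forall X Y (f : hom X Y) x, a Y (fact F f x) = fact G f (a X x)) ->
  exists b : hom F G, forall X x, fcomp b X x = a X x.
Proof.
move=> aB anat.
pose b X : {additive fval F X -> fval G X} := sval (cid (additive_fun_exists (aB X))).
have bE X x : b X x = a X x by rewrite /b; case: (cid _).
have bnat X Y (f : hom X Y) : @comp Abcat _ _ _ (b Y) (fmap F f) =~ @comp Abcat _ _ _ (fmap G f) (b X).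
  move=> x; rewrite /= !bE.
  by apply: etrans (anat X Y f x) _; congr (fact G f _); rewrite bE.
by exists (@NatTrans C Abcat F G b bnat) => X x; apply: bE.
Qed.

(** Preimages under a are unique, so choosing them gives an additive and natural family. *)
Lemma factor_inj F G H (a : hom F G) (b : hom H G) : pointwise_inj a ->
  (forall X x, exists y, fcomp a X y = fcomp b X x) ->
  exists c : hom H F, forall X x, fcomp a X (fcomp c X x) = fcomp b X x.
Proof.
move=> ainj ab; pose g X x := sval (cid (ab X x)).
have gE X x : fcomp a X (g X x) = fcomp b X x by rewrite /g; case: (cid _).
have [X x y|X Y f x|c cE] := @nattrans_exists H F g; last first.
- by exists c => X x; rewrite cE gE.
- by apply: ainj; rewrite fcomp_nat !gE fcomp_nat.
- by apply: ainj; rewrite raddfB !gE raddfB.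
Qed.

(** Two preimages under a differ by an element of its kernel, which b kills; so b of a chosen
    preimage is independent of the choice. *)
Lemma factor_surj F G H (a : hom F G) (b : hom F H) : pointwise_surj a ->
  (forall X x, fcomp a X x = 0 -> fcomp b X x = 0) ->
  exists c : hom G H, forall X x, fcomp c X (fcomp a X x) = fcomp b X x.
Proof.
move=> asurj ab; pose g X y := sval (cid (asurj X y)).
have gE X y : fcomp a X (g X y) = y by rewrite /g; case: (cid _).
have ab' X x y : fcomp a X x = fcomp a X y -> fcomp b X x = fcomp b X y.
  by move/eqP; rewrite -subr_eq0 -raddfB => /eqP/ab/eqP; rewrite raddfB subr_eq0 => /eqP.
have [X x y|X Y f x|c cE] := @nattrans_exists G H (fun X y => fcomp b X (g X y)); last first.
- by exists c => X x; rewrite cE; apply: ab'; rewrite gE.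
- by rewrite -fcomp_nat; apply: ab'; rewrite gE fcomp_nat gE.
- by rewrite -raddfB; apply: ab'; rewrite raddfB !gE.
Qed.

Lemma pointwise_iso F G (a : hom F G) :
  pointwise_inj a -> pointwise_surj a -> is_iso a.
Proof.
move=> ainj asurj.
have [X x|c cE] := @factor_inj F G G a (idm G) ainj.
  by have [y yE] := asurj X x; exists y; rewrite yE.
exists c; split=> X x; last exact: (cE X x).
by apply: (ainj X); apply: (cE X (fcomp a X x)).
Qed.

Lemma iso_of_same_kernel F G H (a : hom F G) (b : hom F H) :
  pointwise_surj a -> pointwise_surj b ->
  (forall X x, fcomp a X x = 0 <-> fcomp b X x = 0) -> exists c : hom G H, is_iso c.
Proof.
move=> sa sb ab; have [X x /ab//|c cE] := factor_surj (b := b) sa.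
exists c; apply: pointwise_iso => [X|X y]; last first.
  by have [x <-] := sb X y; exists (fcomp a X x); rewrite cE.
apply: raddf_inj => y; have [x <-] := sa X y.
by rewrite cE => /ab.
Qed.

(** * Pointwise subfunctors and quotient functors *)

Section Subfunctor.
Variables (F : FC) (N : forall X, fval F X -> Prop).
Hypothesis sN : forall X, subgroup (N (X := X)).
Hypothesis mN : forall X Y (f : hom X Y) x, N x -> N (fact F f x).

Lemma subfunctor_exists : exists G (i : hom G F), pointwise_inj i /\
  forall X x, N (X := X) x <-> exists y, fcomp i X y = x.
Proof.
pose S X := cid (subgroup_type (sN X)).
pose i X := sval (cid (svalP (S X))).
have iinj X : injective (i X) := (svalP (cid (svalP (S X)))).1.
have iP X x : N (X := X) x <-> exists y, i X y = x := (svalP (cid (svalP (S X)))).2 x.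
have ex X Y (f : hom X Y) (x : sval (S X)) : exists y, i Y y = fact F f (i X x).
  by apply/iP/mN/iP; exists x.
pose m X Y f x := sval (cid (ex X Y f x)).
have mE X Y f x : i Y (m X Y f x) = fact F f (i X x) by rewrite /m; case: (cid _).
have mB X Y f x y : m X Y f (x - y) = m X Y f x - m X Y f y.
  by apply: iinj; rewrite raddfB !mE !raddfB.
pose M X Y f : {additive sval (S X) -> sval (S Y)} := sval (cid (additive_fun_exists (mB X Y f))).
have ME X Y f x : M X Y f x = m X Y f x by rewrite /M; case: (cid _).
have h1 X Y (f g : hom X Y) : f =~ g -> @heq Abcat _ _ (M X Y f) (M X Y g).
  by move=> e x; apply: iinj; rewrite !ME !mE (fact_ext _ e).
have h2 X : @heq Abcat _ _ (M X X (idm X)) (idm (sval (S X) : Abcat)).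
  by move=> x; apply: iinj; rewrite ME mE fact_id.
have h3 X Y Z (g : hom Y Z) (f : hom X Y) :
    @heq Abcat _ _ (M X Z (g @o f)) (@comp Abcat _ _ _ (M Y Z g) (M X Y f)).
  by move=> x; apply: iinj; rewrite /= !ME !mE fact_comp ?ME ?mE.
have h4 X Y (f g : hom X Y) :
    @heq Abcat _ _ (M X Y (f +~ g)) (@addm Abcat _ _ (M X Y f) (M X Y g)).
  by move=> x; apply: iinj; rewrite /= raddfD !ME !mE fact_add.
pose G : FC := @Functor C Abcat (fun X => sval (S X)) M h1 h2 h3 h4.
have inat X Y (f : hom X Y) :
    @comp Abcat _ _ _ (i Y) (fmap G f) =~ @comp Abcat _ _ _ (fmap F f) (i X).
  by move=> x; rewrite /= ME mE.
exists G, (@NatTrans C Abcat G F i inat); split; [exact: iinj | exact: iP].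
Qed.

Lemma quotfunctor_exists : exists G (q : hom F G), pointwise_surj q /\
  forall X x, fcomp q X x = 0 <-> N x.
Proof.
pose S X := cid (quotient_type (sN X)).
pose i X := sval (cid (svalP (S X))).
have isurj X y : exists x, i X x = y := (svalP (cid (svalP (S X)))).1 y.
have iP X x : i X x = 0 <-> N (X := X) x := (svalP (cid (svalP (S X)))).2 x.
pose r X y := sval (cid (isurj X y)).
have rE X y : i X (r X y) = y by rewrite /r; case: (cid _).
have iN X x y : i X x = i X y <-> N (X := X) (x - y).
  by rewrite -iP raddfB; split=> [->|/eqP]; rewrite ?subrr // subr_eq0 => /eqP.
pose m X Y f y := i Y (fact F f (r X y)).
have mE X Y f x : m X Y f (i X x) = i Y (fact F f x).
  by apply/iN; rewrite -raddfB; apply/mN/iN.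
have mB X Y f x y : m X Y f (x - y) = m X Y f x - m X Y f y.
  by have [x' <-] := isurj X x; have [y' <-] := isurj X y; rewrite -raddfB !mE !raddfB.
pose M X Y f : {additive sval (S X) -> sval (S Y)} := sval (cid (additive_fun_exists (mB X Y f))).
have ME X Y f x : M X Y f (i X x) = i Y (fact F f x).
  by rewrite -mE /M; case: (cid _).
have h1 X Y (f g : hom X Y) : f =~ g -> @heq Abcat _ _ (M X Y f) (M X Y g).
  by move=> e y; have [x <-] := isurj X y; rewrite !ME (fact_ext _ e).
have h2 X : @heq Abcat _ _ (M X X (idm X)) (idm (sval (S X) : Abcat)).
  by move=> y; have [x <-] := isurj X y; rewrite ME fact_id.
have h3 X Y Z (g : hom Y Z) (f : hom X Y) :
    @heq Abcat _ _ (M X Z (g @o f)) (@comp Abcat _ _ _ (M Y Z g) (M X Y f)).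
  by move=> y; have [x <-] := isurj X y; rewrite /= !ME fact_comp.
have h4 X Y (f g : hom X Y) :
    @heq Abcat _ _ (M X Y (f +~ g)) (@addm Abcat _ _ (M X Y f) (M X Y g)).
  by move=> y; have [x <-] := isurj X y; rewrite /= !ME fact_add raddfD.
pose G : FC := @Functor C Abcat (fun X => sval (S X)) M h1 h2 h3 h4.
have inat X Y (f : hom X Y) :
    @comp Abcat _ _ _ (i Y) (fmap F f) =~ @comp Abcat _ _ _ (fmap G f) (i X).
  by move=> x; rewrite /= ME.
exists G, (@NatTrans C Abcat F G i inat); split; [exact: isurj | exact: iP].
Qed.

End Subfunctor.
End AbFunctors.

(** * Finitely presented functors *)

Section FinitelyPresented.
Variable C : preadd.
Local Notation Co := (opcat C).
Local Notation Mod := (functorcat Co Abcat).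
Implicit Types F G H : Mod.

(** A retyping that lets a morphism of C act on contravariant functors through [fact]. *)
Definition opm (Z Y : C) (g : hom Z Y) : @hom Co Y Z := g.

(* rep Y is Hom(-, Y), valued in zmodTypes: rhom identifies morphisms up to    *)
(* [heq] with the elements of its values.                                      *)
Variables (rep : C -> Mod) (rhom : forall Z Y : C, hom Z Y -> fval (rep Y) Z).

Record representables : Prop := Representables {
  rhom_ext : forall (Z Y : C) (g g' : hom Z Y), g =~ g' -> rhom g = rhom g';
  rhom_inj : forall (Z Y : C) (g g' : hom Z Y), rhom g = rhom g' -> g =~ g';
  rhom_surj : forall (Z Y : C) (x : fval (rep Y) Z), exists g, rhom g = x;
  fact_rhom : forall (Z' Z Y : C) (f : hom Z' Z) (g : hom Z Y),
    fact (rep Y) (opm f) (rhom g) = rhom (g @o f);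
  rhomD : forall (Z Y : C) (g g' : hom Z Y), rhom g + rhom g' = rhom (g +~ g')
}.
Hypothesis repP : representables.

Lemma rhom0 (Z Y : C) : rhom (zerom Z Y) = 0.
Proof.
apply: (addrI (rhom (zerom Z Y))); rewrite rhomD // addr0.
by apply: rhom_ext; rewrite // addm_zero.
Qed.

Lemma rhomN (Z Y : C) (g : hom Z Y) : - rhom g = rhom (oppm g).
Proof.
by apply: (addrI (rhom g)); rewrite subrr rhomD // -rhom0; apply: rhom_ext; rewrite // addm_oppr.
Qed.

Lemma rhomB (Z Y : C) (g g' : hom Z Y) : rhom g - rhom g' = rhom (g +~ oppm g').
Proof. by rewrite rhomN rhomD. Qed.

Lemma fact_opm_ext F (Z Y : C) (g g' : hom Z Y) x :
  g =~ g' -> fact F (opm g) x = fact F (opm g') x.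
Proof. exact: (@fact_ext Co F Y Z). Qed.

Lemma fact_opm_comp F (Z' Z Y : C) (f : hom Z' Z) (g : hom Z Y) x :
  fact F (opm (g @o f)) x = fact F (opm f) (fact F (opm g) x).
Proof. exact: (@fact_comp Co F Y Z Z'). Qed.

Lemma fact_opmB F (Z Y : C) (g g' : hom Z Y) x :
  fact F (opm (g +~ oppm g')) x = fact F (opm g) x - fact F (opm g') x.
Proof.
apply: etrans (@fact_add Co F Y Z (opm g) (opm (oppm g')) x) _; congr (_ + _).
exact: (@fmap_opp Co Abcat F Y Z (opm g') x).
Qed.

(** Elements of [rep Y] are first turned back into morphisms by a choice [d], unique up to [heq];
    then g is sent to F(g)(x). *)
Lemma yoneda F (Y : C) (x : fval F Y) : exists e : hom (rep Y) F,
  forall Z (g : hom Z Y), fcomp e Z (rhom g) = fact F (opm g) x.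
Proof.
pose d (Z : C) (y : fval (rep Y) Z) : hom Z Y := sval (cid (rhom_surj repP y)).
have dE (Z : C) (y : fval (rep Y) Z) : rhom (d Z y) = y by rewrite /d; case: (cid _).
have dr (Z : C) (g : hom Z Y) : d Z (rhom g) =~ g by apply: (rhom_inj repP); rewrite dE.
have [Z y y'|Z Z' f y|e eE] := @nattrans_exists Co (rep Y) F (fun Z y => fact F (opm (d Z y)) x).
- rewrite -fact_opmB; apply: fact_opm_ext; apply: (rhom_inj repP).
  by rewrite dE -rhomB !dE.
- rewrite -[RHS](@fact_opm_comp F Z' Z Y f); apply: fact_opm_ext.
  by apply: (rhom_inj repP); rewrite dE -(fact_rhom repP) dE.
- by exists e => Z g; rewrite eE; apply: fact_opm_ext.
Qed.

Lemma fcomp_rhom_comp F (Y : C) (e : hom (rep Y) F) Z Z' (g : hom Z Y) (f : hom Z' Z) :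
  fcomp e Z' (rhom (g @o f)) = fact F (opm f) (fcomp e Z (rhom g)).
Proof. by rewrite -(fact_rhom repP) fcomp_nat. Qed.

Lemma fcomp_rhom F (Y : C) (e : hom (rep Y) F) Z (g : hom Z Y) :
  fcomp e Z (rhom g) = fact F (opm g) (fcomp e Y (rhom (idm Y))).
Proof.
by rewrite -fcomp_rhom_comp; congr (fcomp e Z _); apply: (rhom_ext repP); rewrite comp_idl.
Qed.

(* e exhibits F as the cokernel of Hom(-, f). *)
Definition presents (X Y : C) (f : hom X Y) F (e : hom (rep Y) F) : Prop :=
  pointwise_surj e /\ forall Z (g : hom Z Y),
    fcomp e Z (rhom g) = 0 <-> exists h : hom Z X, f @o h =~ g.

Definition presentable F : Prop :=
  exists X Y (f : hom X Y) (e : hom (rep Y) F), presents f e.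

Lemma presents_zero (X Y : C) (f : hom X Y) F (e : hom (rep Y) F) Z (h : hom Z X) :
  presents f e -> fcomp e Z (rhom (f @o h)) = 0.
Proof. by move=> [_ ek]; apply/ek; exists h. Qed.

Lemma presents_surj (X Y : C) (f : hom X Y) F (e : hom (rep Y) F) Z x :
  presents f e -> exists g : hom Z Y, fcomp e Z (rhom g) = x.
Proof.
by move=> [es _]; have [y <-] := es Z x; have [g <-] := rhom_surj repP y; exists g.
Qed.

Lemma presentableP F : presentable F <->
  exists X Y (a : hom (rep X) (rep Y)) (e : hom (rep Y) F), forall Z : C,
    (forall x, exists y, fcomp e Z y = x) /\
    (forall y, fcomp e Z y = 0 <-> exists x, fcomp a Z x = y).
Proof.
split=> [[X [Y [f [e pe]]]]|[X [Y [a [e ex]]]]].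
  have [a aE] := yoneda (rhom f); have [esurj ek] := pe.
  have aE' Z (h : hom Z X) : fcomp a Z (rhom h) = rhom (f @o h).
    by rewrite aE (fact_rhom repP).
  exists X, Y, a, e => Z; split=> [|y]; first exact: esurj.
  have [g <-] := rhom_surj repP y; rewrite ek; split=> [[h hE]|[x]].
    by exists (rhom h); rewrite aE' (rhom_ext repP hE).
  by have [h <-] := rhom_surj repP x; rewrite aE' => /(rhom_inj repP) hE; exists h.
have [f fE] := rhom_surj repP (fcomp a X (rhom (idm X))).
have aE Z (h : hom Z X) : fcomp a Z (rhom h) = rhom (f @o h).
  by rewrite fcomp_rhom -fE (fact_rhom repP).
exists X, Y, f, e; split=> [Z y|Z g]; first exact: (ex Z).1.
rewrite (ex Z).2; split=> [[x]|[h hE]]; last first.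
  by exists (rhom h); rewrite aE (rhom_ext repP hE).
by have [h <-] := rhom_surj repP x; rewrite aE => /(rhom_inj repP) hE; exists h.
Qed.

(** Representable functors are projective: b lifts the image under a of the generator of G given by
    the identity of Y1. *)
Lemma presents_lift (X Y : C) (f : hom X Y) F (e : hom (rep Y) F)
    Y1 G (e1 : hom (rep Y1) G) (a : hom G F) : presents f e ->
  exists b : hom Y1 Y, forall Z (g : hom Z Y1),
    fcomp a Z (fcomp e1 Z (rhom g)) = fcomp e Z (rhom (b @o g)).
Proof.
move=> pe; have [b bE] := presents_surj (fcomp a Y1 (fcomp e1 Y1 (rhom (idm Y1)))) pe.
by exists b => Z g; rewrite fcomp_rhom fcomp_nat -bE -fcomp_rhom_comp.
Qed.

Hypothesis addC : additive_cat C.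

(** H has the generators Y of G; its relations are those of G, from f, together with the images of
    the generators of F, from b. So X + Y1 -> Y presents H. *)
Lemma presentable_cokernel F G H (a : hom F G) (q : hom G H) :
  presentable F -> presentable G -> pointwise_surj q ->
  (forall X x, fcomp q X x = 0 <-> exists y, fcomp a X y = x) -> presentable H.
Proof.
move=> [X1 [Y1 [f1 [e1 pe1]]]] [X [Y [f [e pe]]]] qsurj qk.
have [b bE] := presents_lift e1 a pe; have [esurj ek] := pe.
have [_ /(_ X Y1)[B [i1 [i2 [p1 [p2 [e11 e22 e12 e21 _]]]]]]] := addC.
exists B, Y, (f @o p1 +~ b @o p2), (q @o e); split=> [Z z|Z g].
  by have [y <-] := qsurj Z z; have [x <-] := esurj Z y; exists x.
rewrite fcomp_comp; split=> [/qk[y]|[h hE]].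
  have [h <-] := presents_surj y pe1; rewrite bE => e0.
  have [|k kE] := (ek Z (g +~ oppm (b @o h))).1.
    by rewrite -rhomB raddfB e0 subrr.
  exists (i1 @o k +~ i2 @o h); rewrite comp_addr !comp_addl -!comp_assoc.
  rewrite !(comp_assoc p1) !(comp_assoc p2) e11 e12 e21 e22 !comp_idl !comp_zerol.
  by rewrite !comp_zeror addm_zeror addm_zero kE -addm_assoc addm_opp addm_zeror.
apply/qk; exists (fcomp e1 Z (rhom (p2 @o h))).
rewrite bE -(rhom_ext repP hE) -[LHS]add0r.
rewrite -(presents_zero (p1 @o h) pe) -raddfD (rhomD repP); congr (fcomp e Z _).
by apply: (rhom_ext repP); rewrite comp_addl !comp_assoc.
Qed.

(** Compatibility is asked only over Y: the maps g for which [b @o g] factors through a are exactly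
    those that factor through w. *)
Hypothesis weak_pb : forall (Y X Y' : C) (b : hom Y Y') (a : hom X Y'),
  exists (W : C) (w : hom W Y),
    (exists w' : hom W X, b @o w =~ a @o w') /\
    forall Z (g : hom Z Y) (h : hom Z X), b @o g =~ a @o h ->
      exists z : hom Z W, w @o z =~ g.

(** W covers the elements of F killed by a, as the g for which [b @o g] is a relation of G; V covers
    the relations among them, as the z for which [w @o z] is a relation of F. *)
Lemma presentable_kernel F G H (a : hom F G) (k : hom H F) :
  presentable F -> presentable G -> pointwise_inj k ->
  (forall X x, fcomp a X x = 0 <-> exists y, fcomp k X y = x) -> presentable H.
Proof.
move=> [X1 [Y1 [f1 [e1 pe1]]]] [X [Y [f [e pe]]]] kinj kk.
have [b bE] := presents_lift e1 a pe; have [_ ek] := pe; have [_ e1k] := pe1.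
have [W [w [[w' ww'] wP]]] := weak_pb b f.
have [V [v [[v' vv'] vP]]] := weak_pb w f1.
have [x xE] : exists x, fcomp k W x = fcomp e1 W (rhom w).
  by apply/kk; rewrite bE (rhom_ext repP ww'); apply: presents_zero.
have [c cE] := yoneda x.
have kc Z (z : hom Z W) : fcomp k Z (fcomp c Z (rhom z)) = fcomp e1 Z (rhom (w @o z)).
  by rewrite cE fcomp_nat xE -fcomp_rhom_comp.
exists V, W, v, c; split=> [Z y|Z z].
  have [g gE] := presents_surj (fcomp k Z y) pe1.
  have [|h hE] := (ek Z (b @o g)).1.
    by rewrite -bE gE; apply/kk; exists y.
  have [z zE] := wP Z g h (symmetry hE); exists (rhom z); apply: kinj.
  by rewrite kc (rhom_ext repP zE).
split=> [z0|[h hE]].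
  have [|h hE] := (e1k Z (w @o z)).1; first by rewrite -kc z0 raddf0.
  exact: vP Z z h (symmetry hE).
apply: kinj; rewrite kc raddf0; apply/e1k; exists (v' @o h).
by rewrite -hE !comp_assoc vv'.
Qed.

Variable Pr : C -> Prop.

Definition vanishes F : Prop := forall P, Pr P -> forall x : fval F P, x = 0.

Lemma vanishes_inj F G (a : hom F G) : pointwise_inj a -> vanishes G -> vanishes F.
Proof.
by move=> ainj vG P PrP x; apply: ainj; rewrite (vG P PrP (fcomp a P x)) raddf0.
Qed.

Lemma vanishes_surj F G (a : hom F G) : pointwise_surj a -> vanishes F -> vanishes G.
Proof.
by move=> asurj vF P PrP y; have [x <-] := asurj P y; rewrite (vF P PrP x) raddf0.
Qed.

Definition modpr : preadd := fullsub (fun F : Mod => presentable F /\ vanishes F).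

Lemma pointwise_is_kernel (F G K : modpr) (a : hom F G) (k : hom K F) :
  pointwise_inj (k : @hom Mod _ _) ->
  (forall X x, fcomp (a : @hom Mod _ _) X x = 0 <-> exists y, fcomp (k : @hom Mod _ _) X y = x) ->
  is_kernel a k.
Proof.
move=> kinj kk; split; first by apply: fcomp_ext => X x; apply/kk; exists x.
move=> W u au0.
have [X x|c cE] := factor_inj (b := (u : @hom Mod _ _)) kinj.
  by apply/kk; exact: (fcomp_eq x au0).
exists c; first by apply: fcomp_ext => X x; apply: cE.
move=> c' c'E; apply: fcomp_ext => X x; apply: kinj; rewrite cE.
exact: (fcomp_eq x c'E).
Qed.

Lemma pointwise_is_cokernel (F G Q : modpr) (a : hom F G) (q : hom G Q) :
  pointwise_surj (q : @hom Mod _ _) ->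
  (forall X x, fcomp (q : @hom Mod _ _) X x = 0 <-> exists y, fcomp (a : @hom Mod _ _) X y = x) ->
  is_cokernel a q.
Proof.
move=> qsurj qk; split; first by apply: fcomp_ext => X x; apply/qk; exists x.
move=> W u ua0.
have [X x /qk[y <-]|c cE] := factor_surj (b := (u : @hom Mod _ _)) qsurj.
  exact: (fcomp_eq y ua0).
exists c; first by apply: fcomp_ext => X x; apply: cE.
move=> c' c'E; apply: fcomp_ext => X y; have [x <-] := qsurj X y; rewrite cE.
exact: (fcomp_eq x c'E).
Qed.

Lemma kernel_exists (F G : modpr) (a : hom F G) : exists (K : modpr) (k : hom K F),
  pointwise_inj (k : @hom Mod _ _) /\
  forall X x, fcomp (a : @hom Mod _ _) X x = 0 <-> exists y, fcomp (k : @hom Mod _ _) X y = x.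
Proof.
case: F G a => [F [pF vF]] [G [pG vG]] a.
have [||K [k [kinj kk]]] := @subfunctor_exists Co F (fun X x => fcomp (a : @hom Mod F G) X x = 0).
- by move=> X; split; [exact: raddf0 | move=> x y ex ey; rewrite raddfB ex ey subrr].
- by move=> X Y f x ex; rewrite fcomp_nat ex raddf0.
have sK := conj (presentable_kernel pF pG kinj kk) (vanishes_inj kinj vF).
by exists (exist _ K sK), k.
Qed.

Lemma cokernel_exists (F G : modpr) (a : hom F G) : exists (Q : modpr) (q : hom G Q),
  pointwise_surj (q : @hom Mod _ _) /\
  forall X x, fcomp (q : @hom Mod _ _) X x = 0 <-> exists y, fcomp (a : @hom Mod _ _) X y = x.
Proof.
case: F G a => [F [pF vF]] [G [pG vG]] a.
have [||Q [q [qsurj qk]]] :=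
    @quotfunctor_exists Co G (fun X x => exists y, fcomp (a : @hom Mod F G) X y = x).
- move=> X; split; first by exists 0; rewrite raddf0.
  by move=> _ _ [x <-] [y <-]; exists (x - y); rewrite raddfB.
- by move=> X Y f _ [y <-]; exists (fact F f y); rewrite fcomp_nat.
have sQ := conj (presentable_cokernel pF pG qsurj qk) (vanishes_surj qsurj vG).
by exists (exist _ Q sQ), q.
Qed.

(** A monomorphism has zero kernel, so it is pointwise injective and is the pointwise kernel of its
    cokernel; epimorphisms are treated dually. *)
Lemma modpr_abelian : additive_cat modpr -> abelian_cat modpr.
Proof.
move=> addM; split=> // F G a.
- have [K [k [kinj kk]]] := kernel_exists a.
  by exists K, k; apply: pointwise_is_kernel.
- have [Q [q [qsurj qk]]] := cokernel_exists a.
  by exists Q, q; apply: pointwise_is_cokernel.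
- move=> amono; have [K [k [kinj kk]]] := kernel_exists a.
  have k0 : k =~ zerom K F.
    apply: amono; rewrite comp_zeror; exact: (pointwise_is_kernel kinj kk).1.
  have [Q [q [qsurj qk]]] := cokernel_exists a; exists Q, q.
  apply: pointwise_is_kernel => // X; apply: raddf_inj => x /kk[y <-].
  exact: (fcomp_eq y k0).
- move=> aepi; have [Q [q [qsurj qk]]] := cokernel_exists a.
  have q0 : q =~ zerom G Q.
    apply: aepi; rewrite comp_zerol; exact: (pointwise_is_cokernel qsurj qk).1.
  have [K [k [kinj kk]]] := kernel_exists a; exists K, k.
  apply: pointwise_is_cokernel => // X x; apply/qk; exact: (fcomp_eq x q0).
Qed.

End FinitelyPresented.

(** * Stable cokernels of morphisms *)

Section Comparison.
Variable C : preadd.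
Local Notation Co := (opcat C).
Local Notation Mod := (functorcat Co Abcat).
Variables (rep : C -> Mod) (rhom : forall Z Y : C, hom Z Y -> fval (rep Y) Z).
Hypothesis repP : representables rhom.
Hypothesis addC : additive_cat C.
Variables (Pr : C -> Prop) (Inj : forall X Y : C, hom X Y -> Prop).

(* In the application C is the cluster tilting subcategory, Pr its projective   *)
(* modules and Inj its injective maps.                                         *)
Record enough_projectives : Prop := EnoughProjectives {
  ep_cover : forall Y : C, exists (Q : C) (p : hom Q Y),
    Pr Q /\ forall (P : C) (f : hom P Y), Pr P -> exists h : hom P Q, p @o h =~ f;
  ep_hull : forall X : C, exists (Q : C) (i : hom X Q), Pr Q /\ Inj i;
  ep_extend : forall (X Y P : C) (f : hom X Y) (u : hom X P),
    Inj f -> Pr P -> exists v : hom Y P, v @o f =~ u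
}.
Hypothesis epP : enough_projectives.
Hypothesis Inj_id : forall X : C, Inj (idm X).
Hypothesis Inj_comp : forall (X Y Z : C) (g : hom Y Z) (f : hom X Y),
  Inj g -> Inj f -> Inj (g @o f).
Hypothesis Inj_cancel : forall (X Y Z : C) (g : hom Y Z) (f : hom X Y) (h : hom X Z),
  g @o f =~ h -> Inj h -> Inj f.

Definition stably_zero (Z Y : C) (g : hom Z Y) : Prop :=
  exists P, Pr P /\ exists (u : hom Z P) (v : hom P Y), g =~ v @o u.

Lemma stably_zero_ext (Z Y : C) (g g' : hom Z Y) :
  g =~ g' -> stably_zero g -> stably_zero g'.
Proof. by move=> e [P [PrP [u [v h]]]]; exists P; split=> //; exists u, v; rewrite -e. Qed.

Lemma stably_zero_compl (Z Y Y' : C) (b : hom Y Y') (g : hom Z Y) :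
  stably_zero g -> stably_zero (b @o g).
Proof.
by move=> [P [PrP [u [v h]]]]; exists P; split=> //; exists u, (b @o v); rewrite h comp_assoc.
Qed.

Lemma stably_zero_compr (Z' Z Y : C) (g : hom Z Y) (f : hom Z' Z) :
  stably_zero g -> stably_zero (g @o f).
Proof.
by move=> [P [PrP [u [v h]]]]; exists P; split=> //; exists (u @o f), v; rewrite h comp_assoc.
Qed.

Lemma stably_zero_zero (Z Y : C) : stably_zero (zerom Z Y).
Proof.
have [Q [p [PrQ _]]] := ep_cover epP Y.
by exists Q; split=> //; exists (zerom Z Q), p; rewrite comp_zeror.
Qed.

(** Both factorizations are moved to the projective cover of Y, so that one projective serves the
    difference. *)
Lemma stably_zeroB (Z Y : C) (g g' : hom Z Y) :
  stably_zero g -> stably_zero g' -> stably_zero (g +~ oppm g').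
Proof.
move=> [P [PrP [u [v e]]]] [P' [PrP' [u' [v' e']]]].
have [Q [p [PrQ pP]]] := ep_cover epP Y.
have [h hE] := pP _ v PrP; have [h' h'E] := pP _ v' PrP'.
exists Q; split=> //; exists (h @o u +~ oppm (h' @o u')), p.
by rewrite comp_addr comp_oppr !comp_assoc hE h'E e e'.
Qed.

(* g vanishes in the cokernel of the map Hom(-, f) of stable Hom-functors.     *)
Definition stable_image (X Y : C) (f : hom X Y) (Z : C) (g : hom Z Y) : Prop :=
  exists h : hom Z X, stably_zero (g +~ oppm (f @o h)).

Lemma stable_image_ext (X Y : C) (f : hom X Y) (Z : C) (g g' : hom Z Y) :
  g =~ g' -> stable_image f g -> stable_image f g'.
Proof. by move=> e [h hP]; exists h; apply: stably_zero_ext hP; rewrite e. Qed.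

Lemma stable_image_zero (X Y : C) (f : hom X Y) (Z : C) (g : hom Z Y) :
  stably_zero g -> stable_image f g.
Proof.
move=> h; exists (zerom Z X); apply: stably_zero_ext (stably_zeroB h (stably_zero_zero _ _)).
by rewrite comp_zeror.
Qed.

Lemma stable_image_comp (X Y : C) (f : hom X Y) (Z : C) (h : hom Z X) :
  stable_image f (f @o h).
Proof. by exists h; apply: stably_zero_ext (stably_zero_zero _ _); rewrite addm_oppr. Qed.

Lemma stable_imageB (X Y : C) (f : hom X Y) (Z : C) (g g' : hom Z Y) :
  stable_image f g -> stable_image f g' -> stable_image f (g +~ oppm g').
Proof.
move=> [h hP] [h' h'P]; exists (h +~ oppm h').
apply: stably_zero_ext (stably_zeroB hP h'P).
by rewrite comp_addr comp_oppr !oppm_add addmACA.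
Qed.

Lemma stable_image_compr (X Y : C) (f : hom X Y) (Z Z' : C) (g : hom Z Y) (k : hom Z' Z) :
  stable_image f g -> stable_image f (g @o k).
Proof.
move=> [h hP]; exists (h @o k); apply: stably_zero_ext (stably_zero_compr k hP).
by rewrite comp_addl comp_oppl comp_assoc.
Qed.

Lemma stable_image_square (a b : arrow C) (s : square a b) Z (g : hom Z (tgt a)) :
  stable_image (arr a) g -> stable_image (arr b) (sq_tgt s @o g).
Proof.
move=> [h hP]; exists (sq_src s @o h).
apply: stably_zero_ext (stably_zero_compl (sq_tgt s) hP).
by rewrite comp_addr comp_oppr !comp_assoc sq_comm.
Qed.

(** Maps to Y through projectives are the maps through the cover p : Q -> Y, so the stable cokernel
    of f is the ordinary cokernel of (f, p) : X + Q -> Y. *)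
Lemma stable_cokernel_presentable (X Y : C) (f : hom X Y) (F : Mod) (e : hom (rep Y) F) :
  pointwise_surj e ->
  (forall Z (g : hom Z Y), fcomp e Z (rhom g) = 0 <-> stable_image f g) ->
  presentable rhom F.
Proof.
move=> esurj ek; have [Q [p [PrQ pP]]] := ep_cover epP Y.
have [_ /(_ X Q)[B [i1 [i2 [p1 [p2 [e11 e22 e12 e21 _]]]]]]] := addC.
exists B, Y, (f @o p1 +~ p @o p2), e; split=> // Z g; rewrite ek.
split=> [[h [P [PrP [u [v e']]]]]|[k kE]].
  have [w wE] := pP _ v PrP; exists (i1 @o h +~ i2 @o (w @o u)).
  rewrite comp_addr !comp_addl -!comp_assoc.
  rewrite !(comp_assoc p1) !(comp_assoc p2) e11 e12 e21 e22 !comp_idl !comp_zerol.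
  rewrite !comp_zeror addm_zeror addm_zero (comp_assoc p) wE -e'.
  by rewrite addm_comm -addm_assoc addm_opp addm_zeror.
exists (p1 @o k); exists Q; split=> //; exists (p2 @o k), p.
rewrite -kE comp_addl -!comp_assoc (addm_comm (f @o _)) -addm_assoc.
by rewrite addm_oppr addm_zeror.
Qed.

Lemma stable_cokernel_exists (X Y : C) (f : hom X Y) :
  exists (F : modpr rhom Pr) (e : hom (rep Y) (sval F)), pointwise_surj e /\
    forall Z (g : hom Z Y), fcomp e Z (rhom g) = 0 <-> stable_image f g.
Proof.
pose N (Z : Co) (y : fval (rep Y) Z) := exists g : @hom C Z Y, rhom g = y /\ stable_image f g.
have [Z|Z Z' k _ [g [<- gP]]|F [e [esurj ek]]] := @quotfunctor_exists Co (rep Y) N.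
- split.
    exists (@zerom C Z Y); rewrite (rhom0 repP); split=> //.
    exact/stable_image_zero/stably_zero_zero.
  move=> _ _ [g [<- gP]] [g' [<- g'P]]; exists (g +~ oppm g').
  by rewrite (rhomB repP); split=> //; apply: stable_imageB.
- exists (g @o (k : @hom C Z' Z)); split; last exact: stable_image_compr.
  by rewrite -(fact_rhom repP).
have ek' Z (g : hom Z Y) : fcomp e Z (rhom g) = 0 <-> stable_image f g.
  rewrite ek; split=> [[g' [/(rhom_inj repP) g'E]]|gP]; last by exists g.
  exact: stable_image_ext.
have vF : vanishes Pr F.
  move=> P PrP x; have [y <-] := esurj P x; have [g <-] := rhom_surj repP y.
  apply/ek'/stable_image_zero; exists P; split=> //.
  by exists (idm P), g; rewrite comp_idr.
have pF := stable_cokernel_presentable esurj ek'.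
by exists (exist _ F (conj pF vF)), e.
Qed.

(** * The functor Psi *)

Definition injcat : preadd := fullsub (fun a : arrowcat C => Inj (arr a)).
Definition under (a : injcat) : arrow C := sval a.

Definition stable_coker (a : injcat) : modpr rhom Pr :=
  sval (cid (stable_cokernel_exists (arr (under a)))).

Definition stable_coker_map (a : injcat) : hom (rep (tgt (under a))) (sval (stable_coker a)) :=
  sval (cid (svalP (cid (stable_cokernel_exists (arr (under a)))))).
Local Notation coker_map := stable_coker_map.

Lemma coker_map_surj (a : injcat) Z x :
  exists g : hom Z (tgt (under a)), fcomp (coker_map a) Z (rhom g) = x.
Proof.
have [es _] := svalP (cid (svalP (cid (stable_cokernel_exists (arr (under a)))))).
by have [y <-] := es Z x; have [g <-] := rhom_surj repP y; exists g.
Qed.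

Lemma coker_map_eq (a : injcat) Z (g g' : hom Z (tgt (under a))) : g =~ g' ->
  fcomp (coker_map a) Z (rhom g) = fcomp (coker_map a) Z (rhom g').
Proof. by move=> /(rhom_ext repP) ->. Qed.

Lemma coker_map_ker (a : injcat) Z (g : hom Z (tgt (under a))) :
  fcomp (coker_map a) Z (rhom g) = 0 <-> stable_image (arr (under a)) g.
Proof.
by have [_] := svalP (cid (svalP (cid (stable_cokernel_exists (arr (under a)))))); apply.
Qed.

Lemma coker_ext (a : injcat) (G : modpr rhom Pr) (u v : hom (stable_coker a) G) :
  (forall Z (g : hom Z (tgt (under a))),
     fcomp (u : @hom Mod _ _) Z (fcomp (coker_map a) Z (rhom g)) =
     fcomp (v : @hom Mod _ _) Z (fcomp (coker_map a) Z (rhom g))) -> u =~ v.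
Proof.
by move=> e; apply: fcomp_ext => Z x; have [g <-] := coker_map_surj x; apply: e.
Qed.

Lemma coker_square_exists (a b : injcat) (s : hom a b) :
  exists u : hom (stable_coker a) (stable_coker b), forall Z (g : hom Z (tgt (under a))),
    fcomp (u : @hom Mod _ _) Z (fcomp (coker_map a) Z (rhom g)) =
    fcomp (coker_map b) Z (rhom (sq_tgt s @o g)).
Proof.
have [r rE] := yoneda repP (rhom (sq_tgt s)).
have rE' Z (g : hom Z (tgt (under a))) : fcomp r Z (rhom g) = rhom (sq_tgt s @o g).
  by rewrite rE (fact_rhom repP).
have [||u uE] := @factor_surj Co _ _ _ (coker_map a) (coker_map b @o r).
- by move=> Z x; have [g <-] := coker_map_surj x; exists (rhom g).
- move=> Z y; have [g <-] := rhom_surj repP y.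
  rewrite fcomp_comp rE' => /coker_map_ker gP; apply/coker_map_ker.
  exact: (stable_image_square (s : square (under a) (under b)) gP).
by exists u => Z g; rewrite uE fcomp_comp rE'.
Qed.

Definition coker_square (a b : injcat) (s : hom a b) :
    hom (stable_coker a) (stable_coker b) :=
  sval (cid (coker_square_exists s)).

Lemma coker_squareE (a b : injcat) (s : hom a b) Z (g : hom Z (tgt (under a))) :
  fcomp (coker_square s : @hom Mod _ _) Z (fcomp (coker_map a) Z (rhom g)) =
  fcomp (coker_map b) Z (rhom (sq_tgt s @o g)).
Proof. exact: (svalP (cid (coker_square_exists s))). Qed.

Program Definition coker_functor : functor injcat (modpr rhom Pr) :=
  @Functor injcat (modpr rhom Pr) stable_coker coker_square _ _ _ _.
Next Obligation.
move=> a b s t [_ e]; apply: coker_ext => Z g; rewrite !coker_squareE.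
by apply: coker_map_eq; rewrite e.
Qed.
Next Obligation.
move=> a; apply: coker_ext => Z g; rewrite coker_squareE.
by apply: coker_map_eq; rewrite comp_idl.
Qed.
Next Obligation.
move=> a b c t s; apply: coker_ext => Z g.
rewrite [RHS]fcomp_comp !coker_squareE.
by apply: coker_map_eq; rewrite comp_assoc.
Qed.
Next Obligation.
move=> a b s t; apply: coker_ext => Z g; rewrite coker_squareE.
apply: etrans (_ : fcomp (coker_square s : @hom Mod _ _) Z _ +
  fcomp (coker_square t : @hom Mod _ _) Z _ = _) => //.
rewrite !coker_squareE -raddfD (rhomD repP).
by apply: coker_map_eq; rewrite -comp_addl.
Qed.

Lemma coker_functor_dense : dense coker_functor.
Proof.
move=> [F [[X [Y [f [e pe]]]] vF]]; have [esurj ek] := pe.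
have [Q [i [PrQ iInj]]] := ep_hull epP X.
have [_ /(_ Y Q)[B [i1 [i2 [p1 [p2 [e11 e22 e12 e21 eid]]]]]]] := addC.
pose f' := i1 @o f +~ i2 @o i.
have p1f' : p1 @o f' =~ f.
  by rewrite comp_addr !comp_assoc e11 e12 comp_idl comp_zerol addm_zeror.
have p2f' : p2 @o f' =~ i.
  by rewrite comp_addr !comp_assoc e21 e22 comp_idl comp_zerol addm_zero.
pose a : injcat := exist _ (Arrow f' : arrowcat C) (Inj_cancel p2f' iInj).
have [r rE] := yoneda repP (fcomp e B (rhom p1)).
have rE' Z (g : hom Z B) : fcomp r Z (rhom g) = fcomp e Z (rhom (p1 @o g)).
  by rewrite rE (fcomp_rhom_comp repP).
have [|||c ciso] := @iso_of_same_kernel Co _ _ _ (coker_map a) r; last by exists a, c.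
- by move=> Z x; have [g <-] := coker_map_surj x; exists (rhom g).
- move=> Z x; have [g <-] := presents_surj repP x pe; exists (rhom (i1 @o g)).
  rewrite rE'; congr (fcomp e Z _); apply: (rhom_ext repP).
  by rewrite comp_assoc e11 comp_idl.
move=> Z y; have [g <-] := rhom_surj repP y; rewrite rE' ek coker_map_ker.
split=> [[h [P [PrP [u [v e']]]]]|[h hE]].
  (* F vanishes on P, so the component [p1 @o v] of v in Y factors through f. *)
  have [k kE] := (ek P (p1 @o v)).1 (vF P PrP _).
  exists (k @o u +~ h); rewrite comp_addr (comp_assoc f) kE -comp_assoc -e'.
  rewrite comp_addr comp_oppr comp_assoc p1f' -addm_assoc addm_opp.
  by rewrite addm_zeror.
(* The difference of g and [f' @o h] has zero component in Y, hence factors through the summand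
   Q. *)
exists h; exists Q; split=> //; exists (p2 @o (g +~ oppm (f' @o h))), i2.
rewrite -{1}(comp_idl (_ +~ _)) -eid comp_addl -!comp_assoc.
by rewrite {1}comp_addr comp_oppr (comp_assoc p1 f') p1f' hE addm_oppr comp_zeror addm_zero.
Qed.

Lemma coker_functor_full : full coker_functor.
Proof.
move=> a b u.
have [b0 b0E] := coker_map_surj (fcomp (u : @hom Mod _ _) _ (fcomp (coker_map a) _ (rhom (idm (tgt (under a)))))).
have uE Z (g : hom Z (tgt (under a))) :
    fcomp (u : @hom Mod _ _) Z (fcomp (coker_map a) Z (rhom g)) =
    fcomp (coker_map b) Z (rhom (b0 @o g)).
  by rewrite (fcomp_rhom repP) fcomp_nat -b0E -(fcomp_rhom_comp repP).
(* The class of [arr (under a)] is zero in Psi(a), so u sends it to zero in Psi(b). *)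
have [c [P [PrP [v [w e]]]]] : stable_image (arr (under b)) (b0 @o arr (under a)).
  apply/coker_map_ker; rewrite -uE.
  rewrite (coker_map_ker (a := a) (arr (under a))).2 ?raddf0 //.
  by apply: stable_image_ext (stable_image_comp _ (idm _)); rewrite comp_idr.
(* Subtracting [w @o v'] from b0 makes the square commute and leaves the induced map unchanged,
   since [w @o v'] passes through P. *)
have [v' v'E] := ep_extend epP v (svalP a) PrP.
have sq : (b0 +~ oppm (w @o v')) @o arr (under a) =~ arr (under b) @o c.
  rewrite comp_addl comp_oppl -comp_assoc v'E -e oppm_add oppm_opp addm_assoc.
  by rewrite addm_oppr addm_zero.
exists (Square sq : @hom injcat a b); apply: coker_ext => Z g.
rewrite coker_squareE uE; apply/eqP; rewrite -subr_eq0 -raddfB (rhomB repP); apply/eqP.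
apply/coker_map_ker/stable_image_zero; exists P; split=> //.
exists (oppm (v' @o g)), w; rewrite comp_addl comp_oppl comp_oppr comp_assoc.
by rewrite addm_comm addm_assoc addm_opp addm_zero.
Qed.

(** * The induced equivalence on the quotient by U *)

Variable U : injcat -> Prop.
Hypothesis U_id : forall (X : C) (h : Inj (arr (Arrow (idm X)))),
  U (exist _ (Arrow (idm X) : arrowcat C) h).
Hypothesis U_pr : forall (X P : C) (f : hom X P) (h : Inj (arr (Arrow f))),
  Pr P -> U (exist _ (Arrow f : arrowcat C) h).
Hypothesis U_cases : forall a, U a ->
  Pr (tgt (under a)) \/ exists r, arr (under a) @o r =~ idm (tgt (under a)).

(** Every map to the target is zero in Psi(a): either it passes through the projective target
    itself, or it lifts through the right inverse r. *)
Lemma coker_functor_U (a : injcat) : U a -> is_zero (coker_functor a).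
Proof.
move=> Ua; apply: coker_ext => Z g; rewrite [LHS](_ : _ = 0) //.
apply/coker_map_ker; have [PrP|[r rE]] := U_cases Ua.
  by apply: stable_image_zero; exists (tgt (under a)); split=> //; exists g, (idm _); rewrite comp_idl.
by apply: stable_image_ext (stable_image_comp _ (r @o g)); rewrite comp_assoc rE comp_idl.
Qed.

Hypothesis addI : additive_cat injcat.
Definition quotient_coker_functor := quotfunctor addI coker_functor_U.

Lemma quotient_coker_functor_faithful : faithful quotient_coker_functor.
Proof.
move=> a b s t e.
pose f := arr (under a); pose f' := arr (under b); pose d : @hom injcat a b := s +~ oppm t.
(* Evaluating at the class of the identity of the target shows that [sq_tgt d] is [f' @o h] plus a
   map [v @o u] through a projective. *)
have [h [P [PrP [u [v e1]]]]] : stable_image f' (sq_tgt d).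
  apply/coker_map_ker.
  have := fcomp_eq (fcomp (coker_map a) _ (rhom (idm (tgt (under a))))) (e : @heq Mod _ _ _ _).
  rewrite !coker_squareE => /eqP; rewrite -subr_eq0 -raddfB (rhomB repP) => /eqP <-.
  by apply: coker_map_eq; rewrite !comp_idr.
(* [u @o f] may fail to be a monomorphism; with the hull i, [i @o f] is one, hence an object of
   [injcat], and u is recovered as [w @o i]. *)
have [Q [i [PrQ iInj]]] := ep_hull epP (tgt (under a)).
have [w wE] := ep_extend epP u iInj PrP.
pose A1 : injcat := exist _ (Arrow (idm (tgt (under a))) : arrowcat C) (Inj_id _).
pose A2 : injcat := exist _ (Arrow (i @o f) : arrowcat C) (Inj_comp iInj (svalP a)).
pose k1 : @hom injcat a A1 := @Square C (under a) (under A1) f (idm _) (heq_refl _).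
have c1 : (f' @o h) @o idm _ =~ f' @o h by rewrite comp_idr.
pose l1 : @hom injcat A1 b := @Square C (under A1) (under b) h (f' @o h) c1.
have c2 : i @o f =~ (i @o f) @o idm _ by rewrite comp_idr.
pose k2 : @hom injcat a A2 := @Square C (under a) (under A2) (idm _) i c2.
have c3 : (v @o w) @o (i @o f) =~ f' @o (sq_src d +~ oppm (h @o f)).
  rewrite -comp_assoc (comp_assoc w) wE comp_assoc -e1 comp_addl comp_addr.
  by rewrite (sq_comm d) comp_oppl comp_oppr comp_assoc.
pose l2 : @hom injcat A2 b := @Square C (under A2) (under b) _ (v @o w) c3.
have dE : l1 @o k1 +~ l2 @o k2 =~ d.
  split.
    change (h @o f +~ (sq_src d +~ oppm (h @o f)) @o idm _ =~ sq_src d).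
    by rewrite comp_idr addm_comm -addm_assoc addm_opp addm_zeror.
  change ((f' @o h) @o idm _ +~ (v @o w) @o i =~ sq_tgt d).
  by rewrite comp_idr -comp_assoc wE -e1 addm_comm -addm_assoc addm_opp addm_zeror.
apply: (factors_eq dE); apply: (factors_add addI).
  by exists A1; [apply/finite_sum_base/U_id | exists k1, l1].
by exists A2; [apply/finite_sum_base/U_pr | exists k2, l2].
Qed.

Lemma quotient_coker_functor_full : full quotient_coker_functor.
Proof. exact: coker_functor_full. Qed.

Lemma quotient_coker_functor_dense : dense quotient_coker_functor.
Proof. exact: coker_functor_dense. Qed.

Hypothesis weak_pb : forall (Y X Y' : C) (b : hom Y Y') (a : hom X Y'),
  exists (W : C) (w : hom W Y),
    (exists w' : hom W X, b @o w =~ a @o w') /\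
    forall Z (g : hom Z Y) (h : hom Z X), b @o g =~ a @o h ->
      exists z : hom Z W, w @o z =~ g.

Lemma stable_comparison :
  [/\ abelian_cat (quotcat addI U), abelian_cat (modpr rhom Pr) &
      equivalent_cat (quotcat addI U) (modpr rhom Pr)].
Proof.
have fu := quotient_coker_functor_full; have fa := quotient_coker_functor_faithful.
have dn := quotient_coker_functor_dense.
have abM : abelian_cat (modpr rhom Pr).
  exact: (modpr_abelian repP addC weak_pb (additive_dense coker_functor_dense addI)).
split=> //; last exact: (equivalent_ff fu fa dn).
exact: (abelian_ff fu fa dn (quotcat_additive addI U)).
Qed.

End Comparison.

(** * Modules over left self-injective artin algebras *)

Lemma linear_fun_exists (L : pzRingType) (X Y : lmodType L) (g : X -> Y) :
  (forall a x y, g (a *: x + y) = a *: g x + g y) ->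
  exists f : {linear X -> Y}, forall x, f x = g x.
Proof.
move=> gl.
pose f : {linear X -> Y} := HB.pack g (GRing.isLinear.Build L X Y *:%R g gl).
by exists f.
Qed.

Section Submodules.
Variables (L : pzRingType) (A : lmodType L).

Definition submodule (P : A -> Prop) : Prop :=
  P 0 /\ forall a x y, P x -> P y -> P (a *: x + y).

Variable P : A -> Prop.

Lemma submoduleD x y : submodule P -> P x -> P y -> P (x + y).
Proof. by move=> [_ h] Px Py; rewrite -(scale1r x); apply: h. Qed.

Lemma submoduleZ a x : submodule P -> P x -> P (a *: x).
Proof. by move=> [h0 h] Px; rewrite -(addr0 (_ *: _)); apply: h. Qed.

Lemma submoduleB x y : submodule P -> P x -> P y -> P (x - y).
Proof.
by move=> sP Px Py; apply: submoduleD => //; rewrite -scaleN1r; apply: submoduleZ.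
Qed.

Definition subm_pred of submodule P : {pred A} := fun x => `[< P x >].

Fact subm_closed (sP : submodule P) : submod_closed (subm_pred sP).
Proof.
split; first by apply/asboolP; case: sP.
by move=> a x y /asboolP Px /asboolP Py; apply/asboolP; case: sP => _; apply.
Qed.

HB.instance Definition _ (sP : submodule P) :=
  GRing.isSubmodClosed.Build L A (subm_pred sP) (subm_closed sP).

Record subm (sP : submodule P) :=
  Subm { subm_val :> A; subm_valP : subm_val \in subm_pred sP }.

HB.instance Definition _ (sP : submodule P) := [isSub for @subm_val sP].
HB.instance Definition _ (sP : submodule P) := [Choice of subm sP by <:].
HB.instance Definition _ (sP : submodule P) :=
  [SubChoice_isSubLmodule of subm sP by <:].

Lemma submP (sP : submodule P) (x : subm sP) : P (val x).
Proof. by apply/asboolP; apply: (valP x). Qed.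

Definition to_subm (sP : submodule P) x (Px : P x) : subm sP :=
  @Subm sP x (introT (asboolP _) Px).

End Submodules.

Section Extension.
Variables (L : pzRingType) (I : lmodType L).
Hypothesis injI : injective_module I.

(** f descends to the image of h, a submodule of Y, and is extended from there. *)
Lemma injective_extend (X Y : lmodType L) (h : {linear X -> Y}) (f : {linear X -> I}) :
  (forall x, h x = 0 -> f x = 0) -> exists k : {linear Y -> I}, forall x, k (h x) = f x.
Proof.
move=> hf.
have sP : submodule (fun y => exists x, h x = y).
  split; first by exists 0; rewrite linear0.
  by move=> a _ _ [x <-] [y <-]; exists (a *: x + y); rewrite linearP.
have hf' x y : h x = h y -> f x = f y.
  move=> e; apply/eqP; rewrite -subr_eq0 -linearB; apply/eqP/hf.
  by rewrite linearB e subrr.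
pose lift (b : subm sP) : X := sval (cid (submP b)).
have liftE b : h (lift b) = val b by rewrite /lift; case: (cid _).
have [phi phiE] : exists phi : {linear subm sP -> I}, forall b, phi b = f (lift b).
  apply: linear_fun_exists => a x y; rewrite -linearP; apply: hf'.
  by rewrite linearP !liftE.
have [k kE] := injI (g := val : {linear subm sP -> Y}) phi val_inj.
exists k => x; have Px : exists x', h x' = h x by exists x.
have /= := kE (to_subm sP Px); rewrite phiE => ->.
by apply: hf'; rewrite liftE.
Qed.

Lemma injective_ffun k : injective_module {ffun 'I_k -> I}.
Proof.
move=> X Y g f ginj.
have H (i : 'I_k) : exists h : {linear Y -> I}, forall x, h (g x) = f x i.
  have [fi fiE] : exists fi : {linear X -> I}, forall x, fi x = f x i.
    by apply: linear_fun_exists => a x y; rewrite linearP !ffunE.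
  by have [h hE] := injI fi ginj; exists h => x; rewrite -fiE -hE.
pose h i := sval (cid (H i)); have hE i : forall x, h i (g x) = f x i := svalP (cid (H i)).
have [h' h'E] : exists h' : {linear Y -> {ffun 'I_k -> I}}, forall y, h' y = [ffun i => h i y].
  by apply: linear_fun_exists => a x y; apply/ffunP => i; rewrite !ffunE linearP.
by exists h' => x /=; rewrite h'E; apply/ffunP => i; rewrite ffunE hE.
Qed.

Lemma injective_retract (J : lmodType L) (s : {linear J -> I}) (r : {linear I -> J}) :
  (forall x, r (s x) = x) -> injective_module J.
Proof.
move=> rs X Y g f ginj; have [h hE] := injI (s \o f) ginj.
by exists (r \o h) => x /=; have /= -> := hE x.
Qed.

End Extension.

(** Without a minimal member, iterating a choice of strictly smaller members gives a chain that
    contradicts the hypothesis. *)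
Lemma minimal_exists (T : Type) (S : (T -> Prop) -> Prop) :
  (forall N : nat -> T -> Prop, (forall n, S (N n)) ->
    (forall n x, N n.+1 x -> N n x) -> exists n, forall x, N n x -> N n.+1 x) ->
  (exists P, S P) ->
  exists P, S P /\ forall Q, S Q -> (forall x, Q x -> P x) -> forall x, P x -> Q x.
Proof.
move=> chain [P0 SP0]; apply: contrapT => nomin.
have next (P : {P | S P}) : exists Q : {P | S P},
    (forall x, sval Q x -> sval P x) /\ ~ (forall x, sval P x -> sval Q x).
  apply: contrapT => no; apply: nomin; exists (sval P); split; first exact: svalP P.
  move=> Q SQ QP; apply: contrapT => nQ; apply: no.
  by exists (exist _ Q SQ).
pose nx P := sval (cid (next P)); have nxP P := svalP (cid (next P)).
pose N n := sval (iter n nx (exist _ P0 SP0)).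
have [n|n x|n] := chain N; first exact: svalP.
  exact: (nxP _).1.
exact: (nxP _).2.
Qed.

(** * Spans and the descending chain condition *)

Section Span.
Variables (R : pzRingType) (V : zmodType) (act : R -> V -> V).

(** The action is abstract because it stands both for scaling by L and for scaling by R through the
    structure map u. *)
Fixpoint span (s : seq V) (v : V) : Prop :=
  if s is g :: s' then exists c w, span s' w /\ v = act c g + w else v = 0.

Definition stable_subgroup (P : V -> Prop) : Prop :=
  [/\ P 0, forall x y, P x -> P y -> P (x - y) & forall c x, P x -> P (act c x)].

Lemma stable_subgroupD P x y : stable_subgroup P -> P x -> P y -> P (x + y).
Proof.
move=> [P0 PB _] Px Py; have -> : x + y = x - (0 - y) by rewrite sub0r opprK.
exact: PB Px (PB _ _ P0 Py).
Qed.

Hypothesis actDl : forall a b x, act (a + b) x = act a x + act b x.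
Hypothesis actDr : forall a x y, act a (x + y) = act a x + act a y.
Hypothesis actM : forall a b x, act (a * b) x = act a (act b x).

Lemma act0 x : act 0 x = 0.
Proof. by apply: (addrI (act 0 x)); rewrite -actDl !addr0. Qed.

Lemma act_0 a : act a 0 = 0.
Proof. by apply: (addrI (act a 0)); rewrite -actDr !addr0. Qed.

Lemma actN a x : act (- a) x = - act a x.
Proof. by apply: (addrI (act a x)); rewrite -actDl !subrr act0. Qed.

Lemma span_stable s : stable_subgroup (span s).
Proof.
elim: s => [|g s [h0 hB hZ]]; split=> /=.
- by [].
- by move=> x y -> ->; rewrite subrr.
- by move=> c x ->; rewrite act_0.
- by exists 0, 0; rewrite act0 addr0.
- move=> _ _ [c [w [hw ->]]] [c' [w' [hw' ->]]]; exists (c - c'), (w - w').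
  by split; [apply: hB | rewrite actDl actN opprD addrACA].
- move=> a _ [c [w [hw ->]]]; exists (a * c), (act a w).
  by split; [apply: hZ | rewrite actM actDr].
Qed.

Lemma span_mem s c g : g \in s -> span s (act c g).
Proof.
elim: s => // h s IHs; rewrite inE => /predU1P[->|/IHs hg] /=.
  by exists c, 0; split; [case: (span_stable s) | rewrite addr0].
by exists 0, (act c g); rewrite act0 add0r.
Qed.

End Span.

Definition chain_stops (V : Type) (N : nat -> V -> Prop) :=
  exists n, forall x k, (n <= k)%N -> N n x -> N k x.

Section Artinian.
Variables (R : comPzRingType) (V : zmodType) (act : R -> V -> V).
Hypothesis actDl : forall a b x, act (a + b) x = act a x + act b x.
Hypothesis actDr : forall a x y, act a (x + y) = act a x + act a y.
Hypothesis actM : forall a b x, act (a * b) x = act a (act b x).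
Hypothesis artR : artinian R.

(** Induction on the generators: a chain in the span of g and s stops once both its ideals [In n] of
    coefficients at g and its intersections with [span s] do. *)
Lemma artinian_chain_span s (N : nat -> V -> Prop) :
  (forall n, stable_subgroup act (N n)) ->
  (forall n x, N n.+1 x -> N n x) ->
  (forall n x, N n x -> span act s x) -> chain_stops N.
Proof.
elim: s N => [|g s IHs] N Nst Ndec Nspan.
  by exists 0 => x k _ /Nspan /= ->; case: (Nst k).
have [sp0 spB spZ] := span_stable actDl actDr actM s.
have spD := stable_subgroupD (span_stable actDl actDr actM s).
have Ndec' n k x : (n <= k)%N -> N k x -> N n x.
  by move/subnK <-; elim: (k - n)%N => // i IHi /Ndec.
pose In n : {pred R^o} := fun c => `[< exists w, span act s w /\ N n (act c g + w) >].
have [||n1 hn1] := artR (I := In).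
- move=> n; split.
    by apply/asboolP; exists 0; rewrite act0 // addr0; split=> //; case: (Nst n).
  move=> a c d /asboolP[w [hw Nw]] /asboolP[w' [hw' Nw']]; apply/asboolP.
  exists (act a w + w'); split; first by apply: spD => //; apply: spZ.
  rewrite actDl (actM a c) addrACA -actDr.
  by apply: stable_subgroupD => //; case: (Nst n) => _ _; apply.
- move=> n c /asboolP[w [hw Nw]]; apply/asboolP; exists w; split=> //; exact: Ndec.
have [||//|n2 hn2] := IHs (fun n x => N n x /\ span act s x).
- move=> n; have [h0 hB hZ] := Nst n; split=> //.
    by move=> x y [? ?] [? ?]; split; [apply: hB | apply: spB].
  by move=> c x [? ?]; split; [apply: hZ | apply: spZ].
- by move=> n x [? ?]; split=> //; apply: Ndec.
- by move=> n x [].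
exists (maxn n1 n2) => x k; rewrite geq_max => /andP[hk1 hk2] Nx.
have /= [c [w [hw xE]]] := Nspan _ _ Nx.
(* N k therefore has an element with the same coefficient c at g; its difference with x lies in
   [span s], where the chain is constant from n2 on. *)
have Ink : c \in In k.
  rewrite hn1 // -(hn1 (maxn n1 n2)) ?leq_maxl //.
  by apply/asboolP; exists w; rewrite -xE.
have {Ink} /asboolP[w' [hw' Nw']] := Ink.
have [_ NB _] := Nst n2; have [_ NBk _] := Nst k.
have [|h _] := hn2 (w - w') k hk2.
  split; last exact: spB.
  have -> : w - w' = x - (act c g + w') by rewrite xE opprD addrACA subrr add0r.
  by apply: NB; [apply: Ndec' Nx; apply: leq_maxr | apply: Ndec' Nw'].
have -> : x = (act c g + w') + (w - w') by rewrite xE addrACA subrr addr0.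
exact: stable_subgroupD.
Qed.

End Artinian.

Section FiniteGeneration.
Variables (L : pzRingType) (A : lmodType L).

Definition lspan (s : seq A) : A -> Prop := span (fun (a : L) x => a *: x) s.

Lemma lspan_submodule s : submodule (lspan s).
Proof.
have sp : stable_subgroup (fun (a : L) (x : A) => a *: x) (lspan s).
  by apply: span_stable => *; rewrite ?scalerDl ?scalerDr ?scalerA.
split; first by case: sp.
by move=> a x y hx hy; apply: (stable_subgroupD sp) => //; case: sp => _ _; apply.
Qed.

Lemma lspan_mem s g : g \in s -> lspan s g.
Proof.
move=> gs; rewrite -(scale1r g).
apply: (@span_mem _ _ (fun (a : L) x => a *: x)) gs => *.
- by rewrite scalerDl.
- by rewrite scalerDr.
- by rewrite scalerA.
Qed.

Lemma lspan_sub s (P : A -> Prop) :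
  submodule P -> (forall x, x \in s -> P x) -> forall x, lspan s x -> P x.
Proof.
move=> sP; elim: s => [|g s IHs] sub x /=; first by move=> ->; case: sP.
move=> [c [w [hw ->]]]; have [_ h] := sP; apply: h.
  by apply: sub; rewrite mem_head.
by apply: IHs hw => y ys; apply: sub; rewrite inE ys orbT.
Qed.

Lemma fg_lspan : finitely_generated A <-> exists s, forall x, lspan s x.
Proof.
split=> [[n [g gP]]|[s sP]].
  exists (codom g) => x; have [c ->] := gP x.
  have [h0 h] := lspan_submodule (codom g).
  elim/big_ind: _ => // [y z|i _].
    exact: submoduleD (lspan_submodule _).
  by apply: submoduleZ (lspan_submodule _) _; apply/lspan_mem/codom_f.
exists (size s), (fun i => s`_i) => x.
suff [c ->] : exists c : nat -> L, x = \sum_(i < size s) c i *: s`_i.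
  by exists (fun i => c i).
move: x (sP x); clear; elim: s => [|g s IHs] x /=.
  by move=> ->; exists (fun=> 0); rewrite big_ord0.
move=> [c [w [/IHs[d ->] ->]]].
by exists (fun i => if i is j.+1 then d j else c); rewrite big_ord_recl.
Qed.

End FiniteGeneration.

(** * Chains stable under the central subring *)

Section CentralChains.
Variables (L : pzRingType) (R : comPzRingType) (u : {rmorphism R -> L}).
Hypotheses (artR : artinian R) (uC : forall r x, u r * x = x * u r).
Hypothesis fgL : exists n (g : 'I_n -> L), forall x, exists c : 'I_n -> R,
  x = \sum_(i < n) u (c i) * g i.

(** R-submodules: besides L-submodules they cover sets of linear forms, on which L acts from the
    right. *)
Definition central_subgroup (A : lmodType L) (P : A -> Prop) :=
  stable_subgroup (fun c x => u c *: x) P.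

Lemma submodule_central (A : lmodType L) (P : A -> Prop) :
  submodule P -> central_subgroup P.
Proof.
move=> sP; split; first by case: sP.
  by move=> x y; apply: submoduleB.
by move=> c x; apply: submoduleZ.
Qed.

Lemma central_chain_stops (A : lmodType L) (N : nat -> A -> Prop) :
  finitely_generated A -> (forall n, central_subgroup (N n)) ->
  (forall n x, N n.+1 x -> N n x) -> chain_stops N.
Proof.
move=> /fg_lspan[s sA] Nst Ndec; have [n [g gP]] := fgL.
have aDl a b (x : A) : u (a + b) *: x = u a *: x + u b *: x.
  by rewrite rmorphD scalerDl.
have aM a b (x : A) : u (a * b) *: x = u a *: (u b *: x).
  by rewrite rmorphM scalerA.
have aDr a (x y : A) : u a *: (x + y) = u a *: x + u a *: y by rewrite scalerDr.
pose t := [seq a *: x | a <- codom g, x <- s].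
apply: (artinian_chain_span aDl aDr aM artR (s := t)) => // m x _.
have st := span_stable aDl aDr aM t.
have [h0 hB hZ] := st; have hD := stable_subgroupD st.
(* The R-span of t is stable under L: coefficients from R are central, and a product of a generator
   of L with an element of L expands again in those generators. *)
have sub : submodule (span (fun c (x : A) => u c *: x) t).
  split=> // a y z hy hz; apply: (hD _ _ _ hz) => {z hz}.
  suff: forall r, {subset r <= t} -> forall y, span (fun c (x : A) => u c *: x) r y ->
      span (fun c (x : A) => u c *: x) t (a *: y).
    by move=> H; apply: H hy.
  have [c ->] := gP a => {y hy}; elim=> [|z r IHr] zt y /=.
    by move=> ->; rewrite scaler0.
  move=> [d [w [hw ->]]]; rewrite scalerDr; apply: (hD); last first.
    by apply: IHr hw => v vr; apply: zt; rewrite inE vr orbT.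
  rewrite scalerA -uC -scalerA; apply: (hZ).
  have /allpairsP[[b v] /= [_ vs ->]] := zt z (mem_head _ _).
  rewrite scaler_suml; elim/big_ind: _ => // i _.
  rewrite -scalerA; apply: hZ; rewrite scalerA; have [e ->] := gP (g i * b); rewrite scaler_suml.
  elim/big_ind: _ => // k _; rewrite -scalerA.
  apply: (@span_mem _ _ (fun c (x : A) => u c *: x)) => //.
  by apply: allpairs_f => //; apply: codom_f.
apply: lspan_sub sub _ _ (sA x) => y ys.
have [e eE] := gP 1; rewrite -(scale1r y) eE scaler_suml.
elim/big_ind: _ => // k _; rewrite -scalerA.
apply: (@span_mem _ _ (fun c (x : A) => u c *: x)) => //.
by apply: allpairs_f => //; apply: codom_f.
Qed.

Lemma central_minimal (A : lmodType L) (S : (A -> Prop) -> Prop) :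
  finitely_generated A -> (forall P, S P -> central_subgroup P) -> (exists P, S P) ->
  exists P, S P /\ forall Q, S Q -> (forall x, Q x -> P x) -> forall x, P x -> Q x.
Proof.
move=> fgA Sst; apply: minimal_exists => N SN Ndec.
have [||n h] := central_chain_stops fgA (N := N) => //.
  by move=> n; apply: Sst.
by exists n => x; apply: h.
Qed.

End CentralChains.

(** * Finite free modules *)

Section FreeModules.
Variable L : pzRingType.

Definition free_basis k (i : 'I_k) : {ffun 'I_k -> L^o} := [ffun j => (j == i)%:R].

Lemma free_sum k (v : {ffun 'I_k -> L^o}) :
  v = \sum_(i < k) (v i : L) *: free_basis i.
Proof.
apply/ffunP => j; rewrite sum_ffunE (bigD1 j) //= big1 => [|i ij].
  by rewrite !ffunE eqxx /GRing.scale /= mulr1 addr0.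
by rewrite !ffunE eq_sym (negbTE ij) /GRing.scale /= mulr0.
Qed.

Lemma fg_free k : finitely_generated {ffun 'I_k -> L^o}.
Proof. by exists k, (@free_basis k) => v; exists v; apply: free_sum. Qed.

Lemma free_hom k (A : lmodType L) (g : 'I_k -> A) :
  exists f : {linear {ffun 'I_k -> L^o} -> A},
    forall v, f v = \sum_(i < k) (v i : L) *: g i.
Proof.
apply: linear_fun_exists => a x y; rewrite scaler_sumr -big_split /=.
by apply: eq_bigr => i _; rewrite !ffunE scalerDl scalerA.
Qed.

Lemma projective_free k : projective {ffun 'I_k -> L^o}.
Proof.
move=> X Y g f gsurj.
pose l i := sval (cid (gsurj (f (free_basis i)))).
have lE i : g (l i) = f (free_basis i) by rewrite /l; case: (cid _).
have [h hE] := free_hom l; exists h => v /=.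
rewrite hE {2}(free_sum v) !linear_sum; apply: eq_bigr => i _.
by rewrite !linearZ lE.
Qed.

End FreeModules.

(** * Embedding simple modules into L, and its consequences *)

Section Kasch.
Variable L : pzRingType.
Hypothesis hart : artin_algebra L.
Implicit Types (m p : L^o -> Prop).

Lemma fg_regular : finitely_generated L^o.
Proof.
apply/fg_lspan; exists [:: (1 : L^o)] => x; exists x, 0; split=> //.
by rewrite addr0 /GRing.scale /= mulr1.
Qed.

Lemma submodule_minimal (A : lmodType L) (S : (A -> Prop) -> Prop) :
  finitely_generated A -> (forall P, S P -> submodule P) -> (exists P, S P) ->
  exists P, S P /\ forall Q, S Q -> (forall x, Q x -> P x) -> forall x, P x -> Q x.
Proof.
move=> fgA Ssub; have [R [u [artR uC fgL]]] := hart.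
by apply: (central_minimal artR uC fgL fgA) => P /Ssub/submodule_central.
Qed.

(** Simple modules are represented throughout as L/m for such a left ideal m. *)
Definition maximal_ideal m : Prop :=
  [/\ submodule m, ~ m 1 &
      forall I : L^o -> Prop, submodule I -> ~ I 1 -> (forall x, m x -> I x) ->
      forall x, I x -> m x].

Definition lann (x : L) : L^o -> Prop := fun c => c * x = 0.

Lemma lann_submodule x : submodule (lann x).
Proof.
split; first by rewrite /lann mul0r.
by move=> a b c hb hc; rewrite /lann /GRing.scale /= mulrDl -mulrA hb hc mulr0 addr0.
Qed.

Lemma maximal_ideal_exists (I : L^o -> Prop) :
  submodule I -> ~ I 1 -> exists m, maximal_ideal m /\ forall x, I x -> m x.
Proof.
move=> sI I1.
(* The case [set0] is there because [Zorn_bigcup] also asks for the union of the empty chain. *)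
pose P (X : set L^o) := X = set0 \/ [/\ submodule X, ~ X 1 & forall x, I x -> X x].
have [F FP Ftot|m [Pm mmax]] := @Zorn_bigcup L^o P.
  have [[X FX X0]|noX] := pselect (exists2 X, F X & X <> set0); last first.
    left; rewrite -subset0 => x [X FX Xx].
    by apply: noX; exists X => // X0; rewrite X0 in Xx.
  have good Y : F Y -> Y <> set0 -> [/\ submodule Y, ~ Y 1 & forall x, I x -> Y x].
    by move=> /FP[].
  have good' Y y : F Y -> Y y -> [/\ submodule Y, ~ Y 1 & forall x, I x -> Y x].
    by move=> FY Yy; apply: good => // Y0; rewrite Y0 in Yy.
  have [[X00 _] _ IX] := good X FX X0.
  right; split.
  - split; first by exists X.
    move=> a x y [Y FY Yx] [Z FZ Zy].
    have [[_ hY] _ _] := good' _ _ FY Yx; have [[_ hZ] _ _] := good' _ _ FZ Zy.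
    have [YZ|ZY] := Ftot _ _ FY FZ.
      by exists Z => //; apply: hZ => //; apply: YZ.
    by exists Y => //; apply: hY => //; apply: ZY.
  - by move=> [Y FY Y1]; have [_ + _] := good' _ _ FY Y1.
  - by move=> x Ix; exists X => //; apply: IX.
have I0 : I 0 by case: sI.
case: Pm => [m0|[sm m1 Im]].
  case: (mmax I); last by right.
  by rewrite m0; split; [apply: sub0set | move=> /(_ _ I0)].
exists m; split=> //; split=> // J sJ J1 mJ x Jx; apply: contrapT => nmx.
case: (mmax J); last by right; split=> // y /Im/mJ.
by split; [exact: mJ | move=> /(_ _ Jx)].
Qed.

Lemma maximal_ideal_split m a :
  maximal_ideal m -> ~ m a -> exists c t, m t /\ 1 = c * a + t.
Proof.
move=> [sm m1 mmax] ma; have [m0 mD] := sm; apply: contrapT => no.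
apply: ma; apply: (mmax (fun x => exists c t, m t /\ x = c * a + t)).
- split; first by exists 0, 0; rewrite mul0r addr0.
  move=> b _ _ [c [t [mt ->]]] [c' [t' [mt' ->]]]; exists (b * c + c'), (b * t + t').
  split; first exact: mD.
  by rewrite /GRing.scale /= mulrDr mulrDl !mulrA addrACA.
- exact: no.
- by move=> x mx; exists 0, x; rewrite mul0r add0r.
- by exists 1, 0; rewrite mul1r addr0.
Qed.

(* L/m and L/m' are isomorphic: x |-> x a induces a nonzero map L/m -> L/m'. *)
Definition sim m m' : Prop := exists a, ~ m' a /\ forall x, m x -> m' (x * a).

(** The x with [x * a] in m' form a proper left ideal containing m, hence equal to m: a nonzero map
    out of a simple module is injective. *)
Lemma sim_iff m m' a : maximal_ideal m -> submodule m' -> ~ m' a ->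
  (forall x, m x -> m' (x * a)) -> forall x, m' (x * a) -> m x.
Proof.
move=> [_ _ mmax] [m'0 m'D] m'a ma; apply: mmax => //; last by rewrite mul1r.
split; first by rewrite mul0r.
by move=> b x y hx hy; rewrite mulrDl -mulrA; apply: m'D.
Qed.

Lemma sim_sym m m' : maximal_ideal m -> maximal_ideal m' -> sim m m' -> sim m' m.
Proof.
move=> mm mm' [a [m'a ma]]; have [sm' m'1 _] := mm'.
have back := sim_iff mm sm' m'a ma.
have [c [t [m't e]]] := maximal_ideal_split mm' m'a.
exists c; split=> [/ma m'ca|y m'y]; first by apply: m'1; rewrite e; apply: submoduleD.
apply: (back); have -> : y * c * a = y - y * t.
  by rewrite -mulrA -{2}(mulr1 y) e mulrDr addrK.
by apply: submoduleB => //; apply: (submoduleZ y sm' m't).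
Qed.

Lemma sim_trans m m' m'' : maximal_ideal m' -> submodule m'' ->
  sim m m' -> sim m' m'' -> sim m m''.
Proof.
move=> mm' sm'' [a [m'a ma]] [b [m''b mb]].
have back := sim_iff mm' sm'' m''b mb.
exists (a * b); split=> [/back//|x /ma/mb]; by rewrite mulrA.
Qed.

(* p contains a finite intersection of annihilators of elements of simple      *)
(* modules L/m_k, hence L/p is a composition factor of their direct sum.       *)
Lemma inter_sim (K : eqType) (m : K -> L^o -> Prop) (s : seq (K * L)) p :
  (forall k, maximal_ideal (m k)) -> maximal_ideal p ->
  (forall x, (forall kb, kb \in s -> m kb.1 (x * kb.2)) -> p x) ->
  exists kb, kb \in s /\ sim (m kb.1) p.
Proof.
move=> mm mp; have [sp p1 _] := mp.
elim: s => [|[k b] s IHs] sub; first by case: p1; apply: sub.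
pose I x := forall kb, kb \in s -> m kb.1 (x * kb.2).
have [Ip|nIp] := pselect (forall x, I x -> p x).
  by have [kb [kbs h]] := IHs Ip; exists kb; split=> //; rewrite inE kbs orbT.
have ex_e : exists e, I e /\ ~ p e.
  by apply: contrapT => no; apply: nIp => x Ix; apply: contrapT => px; apply: no; exists x.
have [e [Ie pe]] := ex_e.
have IZ a x : I x -> I (a * x).
  move=> Ix kb kbs; rewrite -mulrA; have [smk _ _] := mm kb.1.
  exact: (submoduleZ a smk (Ix _ kbs)).
have IB x y : I x -> I y -> I (x - y).
  move=> Ix Iy kb kbs; rewrite mulrBl; have [smk _ _] := mm kb.1.
  exact: (submoduleB smk (Ix _ kbs) (Iy _ kbs)).
have sub' x : I x -> m k (x * b) -> p x.
  move=> Ix mx; apply: sub => kb; rewrite inE => /predU1P[->//|]; exact: Ix.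
have [smk _ _] := mm k.
have meb : ~ m k (e * b) by move=> /(sub' _ Ie).
(* [c * e] satisfies I, and its product with b is 1 modulo m k; right multiplication by it gives the
   map from L/m k to L/p. *)
have [c [t [mt e1]]] := maximal_ideal_split (mm k) meb.
have ceb y : y * (c * e) * b = y - y * t.
  by rewrite -{2}(mulr1 y) e1 mulrDr addrK !mulrA.
exists (k, b); split; first exact: mem_head.
exists (c * e); split=> [pce|y my].
  apply: pe; have -> : e = (e - (e * b) * (c * e)) + (e * b) * (c * e) by rewrite subrK.
  apply: (submoduleD (P := p) sp); last exact: (submoduleZ (e * b) sp pce).
  apply: sub'; first by apply: IB => //; rewrite mulrA; apply: IZ.
  rewrite mulrBl ceb opprB addrC subrK; exact: (submoduleZ (e * b) smk mt).
apply: sub'; first by rewrite mulrA; apply: IZ.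
by rewrite ceb; apply: (submoduleB (P := m k) smk) => //; apply: (submoduleZ y smk mt).
Qed.

(* The annihilator of the simple module L/m. *)
Definition core m : L^o -> Prop := fun t => forall b, m (t * b).

Lemma core_submodule m : submodule m -> submodule (core m).
Proof.
move=> [m0 mD]; split=> [b|a x y hx hy b]; first by rewrite mul0r.
by rewrite mulrDl -mulrA; apply: mD.
Qed.

Lemma core_sub m x : core m x -> m x.
Proof. by move=> /(_ 1); rewrite mulr1. Qed.

Lemma core_mulr m x b : core m x -> core m (x * b).
Proof. by move=> h c; rewrite -mulrA. Qed.

Lemma core_mull m x b : submodule m -> core m x -> core m (b * x).
Proof. by move=> sm h c; rewrite -mulrA; apply: (submoduleZ b sm (h c)). Qed.

(** By the descending chain condition [core m] is a finite intersection of annihilators of elements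
    of L/m, so [inter_sim] applies with all ideals equal to m. *)
Lemma core_sim m p : maximal_ideal m -> maximal_ideal p ->
  (forall x, core m x -> p x) -> sim m p.
Proof.
move=> mm mp sub; have [sm _ _] := mm.
pose N (s : seq L) (x : L^o) := forall b, b \in s -> m (x * b).
have sN s : submodule (N s).
  have [m0 mD] := sm; split=> [b _|a x y hx hy b bs]; first by rewrite mul0r.
  by rewrite mulrDl -mulrA; apply: mD; [apply: hx | apply: hy].
have [||_ [[s ->] smin]] := submodule_minimal (S := fun P => exists s, P = N s) fg_regular.
- by move=> _ [s ->].
- by exists (N [::]), [::].
have [x Nx|kb [_ h]] := inter_sim (m := fun _ : unit => m)
    (s := [seq (tt, b) | b <- s]) (fun=> mm) mp; last exact: h.
apply: sub => b.
have Nsx : N s x by move=> c cs; apply: (Nx (tt, c)); apply: map_f.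
apply: (smin (N (b :: s)) _ _ x Nsx b (mem_head _ _)); first by exists (b :: s).
by move=> y Ny c cs; apply: Ny; rewrite inE cs orbT.
Qed.

Hypothesis hinj : self_injective L.

(** By left self-injectivity c |-> c b extends along c |-> (c t), t in s, to a form on the free
    module; its values on the basis are the coefficients r. *)
Lemma right_ideal_annihilator (s : seq L) (b : L) :
  (forall c, (forall t, t \in s -> c * t = 0) -> c * b = 0) ->
  exists r : 'I_(size s) -> L, b = \sum_(i < size s) s`_i * r i.
Proof.
move=> hb.
have [h hE] : exists h : {linear L^o -> {ffun 'I_(size s) -> L^o}},
    forall c, h c = [ffun i : 'I_(size s) => c * s`_i].
  apply: linear_fun_exists => a x y; apply/ffunP => i; rewrite !ffunE.
  by rewrite /GRing.scale /= mulrDl mulrA.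
have [f fE] : exists f : {linear L^o -> L^o}, forall c, f c = c * b.
  by apply: linear_fun_exists => a x y; rewrite /GRing.scale /= mulrDl mulrA.
have [|k kE] := injective_extend hinj (h := h) (f := f).
  move=> c; rewrite hE fE => /ffunP h0; apply: hb => t /(nthP 0)[i si <-].
  by have := h0 (Ordinal si); rewrite !ffunE.
exists (fun i => k (free_basis L i)).
have := kE 1; rewrite fE mul1r (free_sum (h 1)) linear_sum => <-.
by apply: eq_bigr => i _; rewrite linearZ hE ffunE mul1r.
Qed.

(* The annihilator of L/m is a proper right ideal, so its left annihilator is   *)
(* nonzero and contains a simple left ideal L x.                               *)
Lemma core_annihilator m : maximal_ideal m ->
  exists x : L, [/\ x <> 0, maximal_ideal (lann x) & forall t, core m t -> x * t = 0].
Proof.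
move=> mm; have [sm m1 _] := mm.
pose T := core m; pose U (x : L^o) := forall t, T t -> x * t = 0.
have sU : submodule U.
  split=> [t _|a x y hx hy t Tt]; first by rewrite mul0r.
  by rewrite mulrDl -mulrA (hx _ Tt) (hy _ Tt) mulr0 addr0.
(* If U were zero, finitely many elements of [core m] would have zero left annihilator by
   minimality, and 1 would lie in the right ideal they generate, inside [core m]. *)
have exU : exists x, U x /\ x <> 0.
  apply: contrapT => no.
  have U0 x : U x -> x = 0.
    by move=> Ux; apply: contrapT => x0; apply: no; exists x.
  pose N (s : seq L) (x : L^o) := forall t, t \in s -> x * t = 0.
  have [||_ [[s [sT ->]] smin]] := submodule_minimal
      (S := fun P => exists s : seq L, (forall t, t \in s -> T t) /\ P = N s) fg_regular.
  - move=> _ [s [_ ->]]; split=> [b _|a x y hx hy b bs]; first by rewrite mul0r.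
    by rewrite mulrDl -mulrA (hx _ bs) (hy _ bs) mulr0 addr0.
  - by exists (N [::]), [::].
  have [c hc|r rE] := @right_ideal_annihilator s 1.
    rewrite mulr1; apply: U0 => t Tt.
    apply: (smin (N (t :: s)) _ _ c hc t (mem_head _ _)).
      exists (t :: s); split=> // t'; rewrite inE => /predU1P[->//|]; exact: sT.
    by move=> y Ny t' t's; apply: Ny; rewrite inE t's orbT.
  have [T0 TD] := core_submodule sm.
  apply: m1; rewrite rE; apply: core_sub; elim/big_ind: _ => [//|x y|i _].
    exact: (submoduleD (core_submodule sm)).
  by apply: core_mulr; apply: sT; apply: mem_nth.
have [||N [[sN NU [x [Nx x0]]] Nmin]] := submodule_minimal
    (S := fun N => [/\ submodule N, forall x, N x -> U x & exists x, N x /\ x <> 0])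
    fg_regular.
- by move=> N [].
- by exists U.
exists x; split=> //; last exact: NU.
split; [exact: lann_submodule | by rewrite /lann mul1r |].
move=> J sJ J1 xJ j Jj; apply: contrapT => jx.
have [J0 JD] := sJ.
(* Minimality gives J x = N, so x = c x for some c in J; then 1 - c annihilates x, hence lies in J,
   and so does 1. *)
pose Q (y : L^o) := exists c, J c /\ y = c * x.
have SQ : [/\ submodule Q, forall x, Q x -> U x & exists x, Q x /\ x <> 0].
  split.
  - split; first by exists 0; rewrite mul0r.
    move=> a _ _ [c [Jc ->]] [d [Jd ->]]; exists (a * c + d); split; first exact: JD.
    by rewrite /GRing.scale /= mulrDl mulrA.
  - by move=> _ [c [Jc ->]]; apply: NU; apply: (submoduleZ c sN Nx).
  - by exists (j * x); split; [exists j | exact: jx].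
have QN y : Q y -> N y by move=> [c [Jc ->]]; apply: (submoduleZ c sN Nx).
have [c [Jc e]] := Nmin Q SQ QN x Nx.
apply: J1; rewrite -(subrK c 1); apply: (submoduleD (P := J) sJ) => //; apply: xJ.
by rewrite /lann mulrBl mul1r -e subrr.
Qed.

(** If the two cores lie in a common maximal p, both simple modules are isomorphic to L/p. Otherwise
    1 = t1 + t2 with ti in the cores, which are two-sided; as [a * x2] lies in x1 L, both t1 and t2
    kill it, so it would be zero. *)
Lemma core_annihilator_sim m1 m2 x1 x2 :
  maximal_ideal m1 -> maximal_ideal m2 ->
  (forall t, core m1 t -> x1 * t = 0) -> (forall t, core m2 t -> x2 * t = 0) ->
  sim (lann x1) (lann x2) -> sim m1 m2.
Proof.
move=> mm1 mm2 h1 h2 [a [ax2 ha]].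
have [sm1 _ _] := mm1; have [sm2 _ _] := mm2.
have [|r rE] := @right_ideal_annihilator [:: x1] (a * x2).
  move=> c hc; rewrite mulrA; apply: ha; apply: hc; exact: mem_head.
move: rE; rewrite big_ord_recl big_ord0 addr0 /= => rE.
pose J (t : L^o) := exists t1 t2, [/\ core m1 t1, core m2 t2 & t = t1 + t2].
have [T10 T1D] := core_submodule sm1; have [T20 T2D] := core_submodule sm2.
have sJ : submodule J.
  split; first by exists 0, 0; rewrite addr0.
  move=> b _ _ [t1 [t2 [? ? ->]]] [t1' [t2' [? ? ->]]].
  exists (b * t1 + t1'), (b * t2 + t2'); split; [exact: T1D | exact: T2D |].
  by rewrite /GRing.scale /= mulrDr addrACA.
have J1 : ~ J 1.
  move=> [t1 [t2 [ht1 ht2 e]]]; apply: ax2; rewrite /lann -(mulr1 (a * x2)) e mulrDr.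
  rewrite {1}rE -!mulrA h2 // mulr0 addr0; apply: h1; exact: core_mull.
have [p [mp Jp]] := maximal_ideal_exists sJ J1; have [sp _ _] := mp.
have s1 : sim m1 p.
  by apply: core_sim => // x hx; apply: Jp; exists x, 0; rewrite addr0.
have s2 : sim m2 p.
  by apply: core_sim => // x hx; apply: Jp; exists 0, x; rewrite add0r.
exact: sim_trans mp sm2 s1 (sim_sym mm2 mp s2).
Qed.

(* If L/m does not embed in L, iterating core_annihilator from m gives          *)
(* infinitely many nonisomorphic simple modules.                               *)
Lemma simple_embeds m : maximal_ideal m ->
  exists y : L, y <> 0 /\ forall c, m c -> c * y = 0.
Proof.
move=> mm; apply: contrapT => no.
pose next (z : {p | maximal_ideal p}) := cid (core_annihilator (svalP z)).
have gm z : maximal_ideal (lann (sval (next z))) by case: (svalP (next z)).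
pose g z : {p | maximal_ideal p} := exist _ _ (gm z).
pose q i := iter i g (exist _ m mm); pose M i := sval (q i).
have MM i : maximal_ideal (M i) by exact: svalP.
have MS i : M i.+1 = lann (sval (next (q i)))  by [].
(* [core_annihilator_sim] lowers both indices down to M 0 = m, where an isomorphism with a left
   ideal L x would embed L/m in L. *)
have nsim i d : ~ sim (M i) (M (i + d.+1)%N).
  elim: i d => [|i IHi] d.
    rewrite add0n MS => -[a [ha ma]]; apply: no.
    exists (a * sval (next (q d))); split=> // c /ma.
    by rewrite /lann mulrA.
  rewrite addSn !MS => h; apply: (IHi d).
  case: (svalP (next (q i))) => _ _ h1; case: (svalP (next (q (i + d.+1)%N))) => _ _ h2.
  exact: core_annihilator_sim (MM _) (MM _) h1 h2 h.
pose N n (x : L^o) := forall i, (i < n)%N -> M i x.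
(* A smallest intersection N n lies inside M n, and [inter_sim] makes L/M n isomorphic to an earlier
   L/M j. *)
have [||_ [[n ->] nmin]] := submodule_minimal (S := fun P => exists n, P = N n) fg_regular.
- move=> _ [n ->]; split=> [i _|a x y hx hy i ilt]; first by case: (MM i) => -[].
  by case: (MM i) => -[_ h] _ _; apply: h; [apply: hx | apply: hy].
- by exists (N 0), 0.
have [x Nx|[i b] [/mapP[j]]] := inter_sim (m := M) (s := [seq (i, 1) | i <- iota 0 n]) MM (MM n).
  apply: (nmin (N n.+1) _ _ x _ n (ltnSn n)); first by exists n.+1.
    by move=> y Ny i ilt; apply: Ny; apply: ltnW.
  move=> i ilt; have := Nx (i, 1); rewrite mulr1; apply.
  by apply: map_f; rewrite mem_iota.
rewrite mem_iota add0n => /andP[_ jn] [-> _] /=.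
by rewrite -(subnKC jn) addSnnS; apply: nsim.
Qed.

(** Modulo [lspan s], the nonzero cyclic module generated by x has a simple quotient L/m, which
    embeds in L through y; the resulting map b + c x |-> c y extends to A by injectivity. *)
Lemma separation (A : lmodType L) (s : seq A) x : ~ lspan s x ->
  exists f : {linear A -> L^o}, (forall y, y \in s -> f y = 0) /\ f x <> 0.
Proof.
move=> sx; have sS := lspan_submodule s; have [S0 SD] := sS.
have [||m [mm Im]] := @maximal_ideal_exists (fun c => lspan s ((c : L) *: x)).
- split; first by rewrite scale0r.
  by move=> a b c hb hc; rewrite scalerDl -scalerA; apply: SD.
- by rewrite scale1r.
have [y [y0 my]] := simple_embeds mm.
have [h hE] : exists h : {linear (subm sS * L^o)%type -> A},
    forall bc, h bc = val bc.1 + (bc.2 : L) *: x.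
  apply: linear_fun_exists => a [b c] [b' c'] /=.
  by rewrite scalerDr scalerA scalerDl addrACA.
have [f fE] : exists f : {linear (subm sS * L^o)%type -> L^o}, forall bc, f bc = bc.2 * y.
  by apply: linear_fun_exists => a [b c] [b' c'] /=; rewrite mulrDl -mulrA.
have [|k kE] := injective_extend hinj (h := h) (f := f).
  move=> [b c]; rewrite hE fE /= => e; apply/my/Im.
  have -> : (c : L) *: x = - val b by apply/eqP; rewrite -addr_eq0 addrC e.
  by rewrite -scaleN1r; apply: submoduleZ => //; apply: submP.
exists k; split=> [z zs|].
  have := kE (to_subm sS (lspan_mem zs), 0); rewrite hE fE /= scale0r addr0 => ->.
  exact: mul0r.
by have := kE (0, 1); rewrite hE fE /= scale1r add0r mul1r => ->.
Qed.

(** A minimal common kernel of finitely many forms is zero, since a form separating one of its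
    elements from 0 would shrink it. *)
Lemma embeds_in_free (A : lmodType L) : finitely_generated A ->
  exists k (f : {linear A -> {ffun 'I_k -> L^o}}), injective f.
Proof.
move=> fgA; pose N (s : seq (linhom A L^o)) x := forall f : linhom A L^o, f \in s -> f x = 0.
have [||_ [[s ->] smin]] := submodule_minimal (S := fun P => exists s, P = N s) fgA.
- move=> _ [s ->]; split=> [f _|a x y hx hy f fs]; first exact: linear0.
  by rewrite linearP hx // hy // scaler0 addr0.
- by exists (N [::]), [::].
have N0 x : N s x -> x = 0.
  move=> Nx; apply: contrapT => x0; have [|f [_ fx]] := @separation A [::] x => //.
  apply: fx; apply: (smin (N (f :: s)) _ _ x Nx f (mem_head _ _)); first by exists (f :: s).
  by move=> y Ny g gs; apply: Ny; rewrite inE gs orbT.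
have [f fE] : exists f : {linear A -> {ffun 'I_(size s) -> L^o}},
    forall x, f x = [ffun i => tnth (in_tuple s) i x].
  by apply: linear_fun_exists => a x y; apply/ffunP => i; rewrite !ffunE linearP.
exists (size s), f => x y e; apply/eqP; rewrite -subr_eq0; apply/eqP/N0 => g gs.
have [i ->] : exists i, g = tnth (in_tuple s) i by apply/tnthP.
have : f (x - y) = 0 by rewrite linearB e subrr.
by rewrite fE => /ffunP/(_ i); rewrite !ffunE.
Qed.

(* L is an injective cogenerator, so a submodule P is recovered from the forms   *)
(* vanishing on it, and those are determined by their values at generators.     *)
Lemma fg_submodule (A : lmodType L) (P : A -> Prop) (sP : submodule P) :
  finitely_generated A -> finitely_generated (subm sP).
Proof.
move=> /[dup] fgA [n [g gP]].
(* Forms vanishing on s, encoded by their values at the generators g; enlarging s inside P shrinks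
   W, and the chain condition over R applies. *)
pose W (s : seq A) (v : {ffun 'I_n -> L^o}) :=
  exists f : {linear A -> L^o}, (forall y, y \in s -> f y = 0) /\ forall i, v i = f (g i).
have [R [u [artR uC fgL]]] := hart.
have [||_ [[s [sP' ->]] smin]] := central_minimal artR uC fgL
    (S := fun Q => exists s : seq A, (forall y, y \in s -> P y) /\ Q = W s) (fg_free L n).
- move=> _ [s [_ ->]]; split.
  + by exists \0; split=> // i; rewrite ffunE.
  + move=> x y [f [f0 fE]] [f' [f'0 f'E]]; exists (f \- f'); split=> [z zs|i] /=.
      by rewrite f0 // f'0 // subrr.
    by rewrite !ffunE fE f'E.
  + move=> c x [f [f0 fE]].
    have [f' f'E] : exists f' : {linear A -> L^o}, forall y, f' y = f y * u c.
      apply: linear_fun_exists => a y z.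
      by rewrite linearP mulrDl /GRing.scale /= mulrA.
    exists f'; split=> [z zs|i]; first by rewrite f'E f0 // mul0r.
    by rewrite ffunE f'E fE -uC.
- by exists (W [::]), [::].
have Ps x : P x -> lspan s x.
  move=> Px; apply: contrapT => nx; have [f [fs fx]] := separation nx.
  have Wf : W s [ffun i => f (g i)] by exists f; split=> // i; rewrite ffunE.
  (* By minimality f has the same values at the generators as a form vanishing at x, hence vanishes
     there itself. *)
  have [f' [f's f'E]] : W (x :: s) [ffun i => f (g i)].
    apply: smin Wf.
      by exists (x :: s); split=> // y; rewrite inE => /predU1P[->//|]; apply: sP'.
    move=> v [f' [f's f'E]]; exists f'; split=> // y ys.
    by apply: f's; rewrite inE ys orbT.
  apply: fx; rewrite -(f's x (mem_head _ _)).
  have [c ->] := gP x; rewrite !linear_sum; apply: eq_bigr => i _.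
  by rewrite !linearZ -f'E ffunE.
apply/fg_lspan.
have [s' s'E] : exists s' : seq (subm sP), [seq val x | x <- s'] = s.
  move: sP'; clear; elim: s => [|x s IHs] sP'; first by exists [::].
  have [|s' <-] := IHs; first by move=> y ys; apply: sP'; rewrite inE ys orbT.
  by exists (to_subm sP (sP' x (mem_head _ _)) :: s').
exists s' => x; have := Ps _ (submP x); rewrite -s'E.
elim: s' {s'E} x => [|y s' IHs] x /=; first by move=> e; apply: val_inj.
move=> [c [w [hw e]]].
have [w' ww'] : exists w' : subm sP, val w' = w.
  have e' : val x = c *: val y + w := e.
  have Pw : P w.
    have -> : w = val x - c *: val y by rewrite e' addrC addKr.
    by apply: submoduleB => //; [|apply: submoduleZ => //]; apply: submP.
  by exists (to_subm sP Pw).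
exists c, w'; split; first by apply: IHs; rewrite ww'.
by apply: val_inj; rewrite linearD linearZ /= ww'.
Qed.

End Kasch.

(** * Projective modules are injective *)

Section ProjectiveModules.
Variable L : pzRingType.

Lemma fg_free_cover (A : lmodType L) : finitely_generated A ->
  exists k (f : {linear {ffun 'I_k -> L^o} -> A}), forall x, exists v, f v = x.
Proof.
move=> [k [g gP]]; have [f fE] := free_hom g; exists k, f => x.
have [c ->] := gP x; exists [ffun i => c i]; rewrite fE.
by apply: eq_bigr => i _; rewrite ffunE.
Qed.

(** P is a direct summand of a finite free module, which is injective because L is. *)
Lemma projective_injective (P : lmodType L) : self_injective L ->
  finitely_generated P -> projective P -> injective_module P.
Proof.
move=> hinj /fg_free_cover[k [r rsurj]] projP.
have [s sE] := projP _ _ r idfun rsurj.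
exact: (injective_retract (injective_ffun hinj (k := k)) (s := s) (r := r) sE).
Qed.

(** By exactness a cocycle kills the kernel of [res_d P j], so it extends along that map. *)
Lemma Ext_injective i (A I : lmodType L) :
  injective_module I -> (0 < i)%N -> Ext_vanishes i A I.
Proof.
case: i => // j injI _ P f fd.
have [|k kE] := injective_extend injI (h := res_d P j) (f := f).
  by move=> x /res_exact[z <-]; apply: fd.
by exists k.
Qed.

End ProjectiveModules.

(** * Covers, hulls and weak pullbacks in M *)

Section ClusterTilting.
Variables (L : pzRingType) (n : nat) (M : modcat L -> Prop).
Hypotheses (hart : artin_algebra L) (hinj : self_injective L).
Hypotheses (hM : cluster_tilting M n).
Local Notation S := (subcat M).

(** This puts the finite free modules into M, from which projective covers and hulls are taken. *)
Lemma ct_injective (A : fgmod L) : injective_module A -> M A.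
Proof.
move=> injA; apply/(ct_right hM) => X _ i /andP[i0 _]; exact: Ext_injective.
Qed.

Definition free_object k : S :=
  exist _ (FgMod (fg_free L k)) (@ct_injective (FgMod (fg_free L k)) (injective_ffun hinj (k := k))).

Lemma free_object_projective k : projective (modof (free_object k)).
Proof. exact: projective_free. Qed.

Lemma projective_object_injective (P : S) : projective (modof P) -> injective_module (modof P).
Proof. by apply: projective_injective => //; apply: fgmodP. Qed.

Lemma projective_cover (Y : S) : exists (Q : S) (p : hom Q Y),
  projective (modof Q) /\ forall y, exists x, mapof p x = y.
Proof.
have [k [p pP]] := fg_free_cover (fgmodP (modof Y)).
exists (free_object k), p; split=> //; exact: free_object_projective.
Qed.

Lemma projective_hull (X : S) : exists (Q : S) (i : hom X Q),
  projective (modof Q) /\ injective (mapof i).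
Proof.
have [k [i iP]] := embeds_in_free hart hinj (fgmodP (modof X)).
exists (free_object k), i; split=> //; exact: free_object_projective.
Qed.

Lemma hom_extend (X Y P : S) (f : hom X Y) (u : hom X P) :
  projective (modof P) -> injective (mapof f) -> exists v : hom Y P, v @o f =~ u.
Proof. by move=> /projective_object_injective injP finj; apply: (injP _ _ f u finj). Qed.

Lemma hom_lift (P X Y : S) (g : hom X Y) (f : hom P Y) :
  projective (modof P) -> (forall y, exists x, mapof g x = y) ->
  exists h : hom P X, g @o h =~ f.
Proof. by move=> projP gsurj; apply: (projP _ _ g f gsurj). Qed.

Lemma weak_pullback (Y X Y' : S) (b : hom Y Y') (a : hom X Y') :
  exists (W : S) (w : hom W Y),
    (exists w' : hom W X, b @o w =~ a @o w') /\
    forall Z (g : hom Z Y) (h : hom Z X), b @o g =~ a @o h ->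
      exists z : hom Z W, w @o z =~ g.
Proof.
have [_ /(_ Y X)[B [i1 [i2 [p1 [p2 [e11 e22 e12 e21 _]]]]]]] := ct_additive hM.
have sP : submodule (fun x : modof B => mapof b (mapof p1 x) = mapof a (mapof p2 x)).
  by split=> [|c x y ex ey]; rewrite ?linear0 // !linearP ex ey.
(* K is the pullback of modules inside Y + X. It is replaced by a right M-approximation r, through
   which every map from an object of M to K factors. *)
pose K := FgMod (fg_submodule hart hinj sP (fgmodP (modof B))).
have [[W [r [MW rP]]] _] := ct_ffinite hM K.
pose W' : S := exist _ W MW.
pose j : {linear K -> modof B} := val.
pose wB : hom W' B := j \o r.
exists W', (p1 @o wB); split.
  by exists (p2 @o wB) => x; apply: (submP (r x)).
move=> Z g h gh.
pose t : hom Z B := i1 @o g +~ i2 @o h.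
have p1t : p1 @o t =~ g.
  by rewrite /t comp_addr !comp_assoc e11 e12 comp_idl comp_zerol addm_zeror.
have p2t : p2 @o t =~ h.
  by rewrite /t comp_addr !comp_assoc e21 e22 comp_idl comp_zerol addm_zero.
have tP x : mapof b (mapof p1 (mapof t x)) = mapof a (mapof p2 (mapof t x)).
  apply: etrans (congr1 (mapof b) (p1t x)) _.
  by apply: etrans (gh x) (esym (congr1 (mapof a) (p2t x))).
have [t' t'E] : exists t' : {linear modof Z -> K}, forall x, t' x = to_subm sP (tP x).
  by apply: linear_fun_exists => c x y; apply: val_inj; exact: (linearP (mapof t)).
have [z zE] := rP (sval Z) t' (svalP Z).
exists z => x; apply: etrans (p1t x); congr (mapof p1 _).
by apply: etrans (congr1 j (zE x)) _; rewrite t'E.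
Qed.

End ClusterTilting.

(** * The comparison for cluster tilting subcategories *)

Section Representables.
Variables (L : pzRingType) (M : modcat L -> Prop).
Local Notation S := (subcat M).
Local Notation Mod := (functorcat (opcat S) Abcat).
Local Notation rep := (@representable L M : S -> Mod).

Definition linhom_rhom (Z Y : S) (g : hom Z Y) : fval (rep Y) Z := g.

Lemma linhom_representables : representables linhom_rhom.
Proof.
split.
- by move=> Z Y g g' e; apply: linhom_ext.
- by move=> Z Y g g'; rewrite /linhom_rhom => ->.
- by move=> Z Y x; exists x.
- by [].
- by move=> Z Y g g'; apply: linhom_ext.
Qed.

Definition object_projective (P : S) : Prop := projective (modof P).

(** Extensionality of predicates makes this an equality of categories, so that it can be rewritten
    with; Yoneda supplies the equivalence of the two notions of presentation. *)
Lemma stable_modcat_modpr :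
  stable_modcat M = modpr linhom_rhom object_projective.
Proof.
rewrite /stable_modcat /modpr; congr fullsub; apply/funext => F.
apply/propext; split=> -[fpF vF]; split=> //; exact/(presentableP linhom_representables).
Qed.

End Representables.

Section ClusterTiltingComparison.
Variables (L : pzRingType) (n : nat) (M : modcat L -> Prop).
Hypotheses (hart : artin_algebra L) (hinj : self_injective L).
Hypothesis hM : cluster_tilting M n.
Local Notation S := (subcat M).

Definition object_monic (X Y : S) (f : hom X Y) : Prop := injective (mapof f).

Lemma ct_enough_projectives :
  enough_projectives (@object_projective L M) object_monic.
Proof.
split=> [Y|X|X Y P f u finj projP].
- have [Q [p [projQ psurj]]] := projective_cover hinj hM Y.
  by exists Q, p; split=> // P f projP; apply: hom_lift.
- exact: projective_hull hart hinj hM X.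
- exact: hom_extend hinj _ _ _ _ _ projP finj.
Qed.

Lemma Ugen_cases (a : monocat M) : Ugen a ->
  object_projective (tgt (sval a)) \/
  exists r, arr (sval a) @o r =~ idm (tgt (sval a)).
Proof.
rewrite /Ugen; case: (sval a) / => [X|X P f projP]; last by left.
by right; exists (idm X); rewrite comp_idl.
Qed.

End ClusterTiltingComparison.

Theorem corollary3p3p2 (L : pzRingType) (n : nat) (M : modcat L -> Prop)
    (hart : artin_algebra L) (hinj : self_injective L)
    (hn : (1 < n)%N) (hM : cluster_tilting M n) :
  let SM_U := quotcat (monocat_additive (ct_additive hM)) (Ugen (M:=M)) in
  [/\ abelian_cat SM_U, abelian_cat (stable_modcat M) &
      equivalent_cat SM_U (stable_modcat M)].
Proof.
rewrite stable_modcat_modpr.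
(* With injective maps for [Inj], [injcat] unfolds to [monocat]. The goals left are the closure
   properties of injective maps, the description of U, and weak pullbacks. *)
apply: (stable_comparison (linhom_representables M) (ct_additive hM)
  (ct_enough_projectives hart hinj hM) (Inj := @object_monic L M)).
- by move=> X x y.
- by move=> X Y Z g f ginj finj x y /ginj/finj.
- move=> X Y Z g f h e hinj' x y fxy; apply: hinj'.
  by apply: etrans (esym (e x)) (etrans _ (e y)); exact: (congr1 (mapof g) fxy).
- by move=> X h; apply: generator_id.
- by move=> X P f h projP; apply: generator_proj.
- exact: Ugen_cases.
- exact: weak_pullback hart hinj hM.
Qed.
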